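(* Let $F_2$ be the free group on two generators, let $\widehat{F_2}$ be its profinite completion, and let $\widehat{\operatorname{Out} F_2}$ be the profinite completion of the outer automorphism group $\operatorname{Out} F_2$. Then the natural continuous homomorphism $\widehat{\operatorname{Out} F_2} \to \operatorname{Out} \widehat{F_2}$ is injective.
   Context: For a discrete group $G$, $\widehat{G}$ denotes its profinite completion. For a profinite group $\mathfrak{F}$, $\operatorname{Aut} \mathfrak{F}$ denotes the group of continuous automorphisms of $\mathfrak{F}$, $\operatorname{Int} \mathfrak{F}$ the group of inner automorphisms, and $\operatorname{Out} \mathfrak{F} = \operatorname{Aut} \mathfrak{F}/\operatorname{Int} \mathfrak{F}$. If $\mathfrak{F}$ is finitely generated (as a profinite group), then $\operatorname{Aut} \mathfrak{F}$ is a profinite group: letting $U_n$ be the intersection of all open subgroups of index $\leqslant n$ (an open characteristic subgroup), one has $\operatorname{Aut}\mathfrak{F} = \varprojlim \operatorname{Aut}(\mathfrak{F}/U_n)$; the quotient $\operatorname{Out}\mathfrak{F}$ is then also profinite. For a finitely generated discrete group $G$, every automorphism of $G$ extends uniquely to a continuous automorphism of $\widehat{G}$, giving a homomorphism $\operatorname{Aut} G \to \operatorname{Aut}\widehat{G}$ and an induced homomorphism $\operatorname{Out} G \to \operatorname{Out}\widehat{G}$. Since $\operatorname{Out}\widehat{G}$ is profinite, the latter extends uniquely to a continuous homomorphism $\widehat{\operatorname{Out} G} \to \operatorname{Out}\widehat{G}$, which is the natural homomorphism in the statement. *)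

(* Defs.v *)
From HB Require Import structures.
From mathcomp Require Import all_boot.
From mathcomp Require Import all_classical.
From mathcomp Require Import topology.

Set Implicit Arguments.
Unset Strict Implicit.
Unset Printing Implicit Defensive.

Local Open Scope classical_set_scope.
Local Open Scope card_scope.
Local Open Scope quotient_scope.
Local Open Scope group_scope.

(* Free groups as groups of reduced words: (x, true) stands for the generator x
   and (x, false) for its inverse. *)

Section FreeGroup.
Variable X : choiceType.
Implicit Types (a b : X * bool) (w u v : seq (X * bool)).

Definition letter_inv a := (a.1, ~~ a.2).

Definition reduced w := sorted (fun a b => b != letter_inv a) w.

Definition push a w :=
  if w is b :: w' then if b == letter_inv a then w' else a :: w else [:: a].

Record free_group := FreeGroup {
  word :> seq (X * bool);
  wordP : reduced word }.

HB.instance Definition _ := [isSub for word].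
HB.instance Definition _ := [Choice of free_group by <:].

Lemma letter_invK : involutive letter_inv.
Proof. by case=> x b; rewrite /letter_inv /= negbK. Qed.

Lemma push_reduced a w : reduced w -> reduced (push a w).
Proof.
case: w => [|b w] //= rw; case: ifPn => [_|ba].
  exact: path_sorted rw.
by rewrite /= ba.
Qed.

Lemma pushK a w : reduced w -> push (letter_inv a) (push a w) = w.
Proof.
case: w => [|b w] rw /=; first by rewrite letter_invK eqxx.
case: ifPn => [/eqP ba|_] /=; last by rewrite letter_invK eqxx.
rewrite -ba.
by case: w rw => [|c w] //= /andP[/negPf ->].
Qed.

Lemma pushVK a w : reduced w -> push a (push (letter_inv a) w) = w.
Proof. by move=> rw; rewrite -{1}[a]letter_invK pushK. Qed.

Definition word_mul u v := foldr push v u.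
Definition word_inv u := rev (map letter_inv u).

Lemma word_mul_reduced u v : reduced v -> reduced (word_mul u v).
Proof. by move=> rv; elim: u => //= a u IH; exact: push_reduced. Qed.

Lemma word_inv_reduced u : reduced u -> reduced (word_inv u).
Proof.
rewrite /reduced /word_inv rev_sorted sorted_map => ru.
rewrite (eq_sorted _ (e' := fun a b => b != letter_inv a)) // => a b /=.
by rewrite letter_invK eq_sym.
Qed.

Lemma word_mul_push a u v :
  reduced v -> word_mul (push a u) v = push a (word_mul u v).
Proof.
move=> rv; case: u => [|b u] //=; case: ifPn => [/eqP ->|//].
by rewrite pushVK //; exact: word_mul_reduced.
Qed.

Lemma word_mulA u v w :
  reduced w -> word_mul u (word_mul v w) = word_mul (word_mul u v) w.
Proof. by move=> rw; elim: u => //= a u IH; rewrite word_mul_push // IH. Qed.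

Lemma word_mul1 u : reduced u -> word_mul u [::] = u.
Proof.
elim: u => //= a u IH ru; rewrite IH; last exact: path_sorted ru.
by case: u ru {IH} => //= b u /andP[/negPf ->].
Qed.

Lemma word_mulV u : word_mul (word_inv u) u = [::].
Proof.
elim: u => // a u IH; rewrite /word_inv /= rev_cons /word_mul foldr_rcons /=.
by rewrite letter_invK eqxx.
Qed.

Lemma word_invK : involutive word_inv.
Proof.
by move=> u; rewrite /word_inv map_rev revK -map_comp map_id_in // => a _ /=;
  rewrite letter_invK.
Qed.

Definition free_one : free_group := Sub [::] isT.
Definition free_mul (u v : free_group) : free_group :=
  Sub (word_mul (val u) (val v)) (word_mul_reduced _ (valP v)).
Definition free_inv (u : free_group) : free_group :=
  Sub (word_inv (val u)) (word_inv_reduced (valP u)).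

Lemma free_mulA : associative free_mul.
Proof. by move=> u v w; apply/val_inj; exact: word_mulA (valP w). Qed.
Lemma free_mul1g : left_id free_one free_mul.
Proof. by move=> u; exact/val_inj. Qed.
Lemma free_mulg1 : right_id free_one free_mul.
Proof. by move=> u; apply/val_inj; exact: word_mul1 (valP u). Qed.
Lemma free_mulVg : left_inverse free_one free_inv free_mul.
Proof. by move=> u; apply/val_inj; exact: word_mulV. Qed.
Lemma free_mulgV : right_inverse free_one free_inv free_mul.
Proof.
move=> u; apply/val_inj => /=.
by have := word_mulV (word_inv (word u)); rewrite word_invK.
Qed.

HB.instance Definition _ := isGroup.Build free_group
  free_mulA free_mul1g free_mulg1 free_mulVg free_mulgV.

End FreeGroup.

Definition F2 : groupType := free_group 'I_2.

Record subgroup (G : groupType) := Subgroup {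
  carrier :> set G;
  subgroupP : group_closed [in carrier] }.

Record normal_subgroup (G : groupType) := NormalSubgroup {
  normal_subgroup_sub :> subgroup G;
  normal_subgroupJ : forall x y,
    carrier normal_subgroup_sub x -> carrier normal_subgroup_sub (x ^ y) }.

Section Subgroup.
Variables (G : groupType) (H : subgroup G).

Lemma subgroup1 : carrier H 1.
Proof. by case: (subgroupP H) => + _; rewrite !inE. Qed.
Lemma subgroupM x y : carrier H x -> carrier H y -> carrier H (x * y).
Proof.
move=> Hx Hy; have := group_closedM (subgroupP H).
by move=> /(_ x y); rewrite !inE; apply.
Qed.
Lemma subgroupV x : carrier H x -> carrier H x^-1.
Proof.
by move=> Hx; have /(_ x) := group_closedV (subgroupP H); rewrite !inE; apply.
Qed.

Definition coset_rel : rel G := fun x y => `[< carrier H (x^-1 * y) >].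

Lemma coset_rel_equiv : equiv_class_of coset_rel.
Proof.
split=> [x|x y|y x z]; rewrite /coset_rel.
- by apply/asboolP; rewrite mulVg; exact: subgroup1.
- by apply/asbool_equiv_eq; split=> /subgroupV; rewrite invgM invgK.
- move=> /asboolP xy /asboolP yz; apply/asboolP.
  by have := subgroupM xy yz; rewrite mulgA mulgK.
Qed.

Canonical coset_equiv := EquivRelPack coset_rel_equiv.

(* the set G/H of left cosets *)
Definition coset_space := {eq_quot coset_equiv}.

HB.instance Definition _ := EqQuotient.on coset_space.
HB.instance Definition _ := Choice.on coset_space.

Lemma coset_eqP x y : reflect (\pi_coset_space x = \pi_coset_space y)
  `[< carrier H (x^-1 * y) >].
Proof. exact: (@eqmodP _ coset_equiv). Qed.

End Subgroup.

Section QuotientGroup.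
Variables (G : groupType) (N : normal_subgroup G).

Definition quotient_group := coset_space N.

HB.instance Definition _ := EqQuotient.on quotient_group.
HB.instance Definition _ := Choice.on quotient_group.

Local Notation cl x := (\pi_quotient_group x).

Definition quot_mul (p q : quotient_group) : quotient_group :=
  cl (repr p * repr q).
Definition quot_inv (p : quotient_group) : quotient_group := cl (repr p)^-1.

Lemma quot_reprP x : carrier N ((repr (cl x))^-1 * x).
Proof. by apply/asboolP/coset_eqP; rewrite reprK. Qed.

Lemma quot_mulE x y : quot_mul (cl x) (cl y) = cl (x * y).
Proof.
apply/coset_eqP/asboolP; rewrite invgM.
have := normal_subgroupJ y (quot_reprP x); rewrite conjgE => Nx.
have := subgroupM (quot_reprP y) Nx.
by rewrite !mulgA mulgK.
Qed.

Lemma quot_invE x : quot_inv (cl x) = cl x^-1.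
Proof.
apply/coset_eqP/asboolP; rewrite invgK.
have /subgroupV := quot_reprP x; rewrite invgM invgK.
by move=> /(normal_subgroupJ x^-1); rewrite conjgE invgK -mulgA mulVKg.
Qed.

Lemma quot_mulA : associative quot_mul.
Proof.
elim/quotW=> x; elim/quotW=> y; elim/quotW=> z.
by rewrite (quot_mulE y z) (quot_mulE x y) !quot_mulE mulgA.
Qed.
Lemma quot_mul1g : left_id (cl 1) quot_mul.
Proof. by move=> p; rewrite -[p]reprK quot_mulE mul1g. Qed.
Lemma quot_mulg1 : right_id (cl 1) quot_mul.
Proof. by move=> p; rewrite -[p]reprK quot_mulE mulg1. Qed.
Lemma quot_mulVg : left_inverse (cl 1) quot_inv quot_mul.
Proof. by move=> p; rewrite -[p]reprK quot_invE quot_mulE mulVg. Qed.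
Lemma quot_mulgV : right_inverse (cl 1) quot_inv quot_mul.
Proof. by move=> p; rewrite -[p]reprK quot_invE quot_mulE mulgV. Qed.

HB.instance Definition _ := isGroup.Build quotient_group
  quot_mulA quot_mul1g quot_mulg1 quot_mulVg quot_mulgV.

Lemma piM x y : cl (x * y) = cl x * cl y.
Proof. by rewrite -quot_mulE. Qed.
Lemma piV x : cl (x^-1) = (cl x)^-1.
Proof. by rewrite -quot_invE. Qed.

(* The same group structure, on the copy of the quotient that carries the
   quotient topology (which has its own choiceType structure). *)
HB.instance Definition _ := @isGroup.Build (quotient_topology quotient_group)
  (cl 1) quot_inv quot_mul
  quot_mulA quot_mul1g quot_mulg1 quot_mulVg quot_mulgV.

End QuotientGroup.

HB.mixin Record Group_isTopologicalGroup G of Group G & Topological G := {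
  mulg_continuous : continuous (fun p : G * G => p.1 * p.2);
  invg_continuous : continuous (fun x : G => x^-1) }.

#[short(type="topologicalGroupType")]
HB.structure Definition TopologicalGroup :=
  {G of Group G & Topological G & Group_isTopologicalGroup G}.

(* An automorphism is given together with its (unique) inverse. *)
Record aut (G : groupType) := Automorphism {
  aut_fun :> G -> G;
  aut_inv : G -> G;
  aut_funK : cancel aut_fun aut_inv;
  aut_invK : cancel aut_inv aut_fun;
  autM : {morph aut_fun : x y / x * y} }.

HB.instance Definition _ G := gen_eqMixin (aut G).
HB.instance Definition _ G := gen_choiceMixin (aut G).

Section Aut.
Variable G : groupType.
Implicit Types f g h : aut G.

Lemma autP f g : f =1 g -> f = g.
Proof.
case: f g => [f f' fK f'K fM] [g g' gK g'K gM] /= /funext fg.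
rewrite -{}fg in gK g'K gM *.
have f'g' : f' = g' by apply/funext => x; rewrite -{1}[x]g'K fK.
by rewrite -{}f'g' in gK g'K *; congr Automorphism; exact: Prop_irrelevance.
Qed.

Lemma aut_compM f g : {morph f \o g : x y / x * y}.
Proof. by move=> x y; rewrite /= !autM. Qed.

Lemma aut_invM f : {morph aut_inv f : x y / x * y}.
Proof.
by move=> x y; apply: (can_inj (aut_funK f)); rewrite autM !aut_invK.
Qed.

Definition aut_one : aut G :=
  @Automorphism G idfun idfun (fun=> erefl) (fun=> erefl) (fun _ _ => erefl).
(* (f * g) x = f (g x) *)
Definition aut_mul f g : aut G := Automorphism
  (can_comp (aut_funK f) (aut_funK g)) (can_comp (aut_invK g) (aut_invK f))
  (@aut_compM f g).
Definition aut_opp f : aut G := Automorphism (aut_invK f) (aut_funK f)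
  (@aut_invM f).

End Aut.

Section AutGroup.
Variable G : groupType.

Lemma aut_mulA : associative (@aut_mul G).
Proof. by move=> f g h; exact: autP. Qed.
Lemma aut_mul1g : left_id (@aut_one G) (@aut_mul G).
Proof. by move=> f; exact: autP. Qed.
Lemma aut_mulg1 : right_id (@aut_one G) (@aut_mul G).
Proof. by move=> f; exact: autP. Qed.
Lemma aut_mulVg : left_inverse (@aut_one G) (@aut_opp G) (@aut_mul G).
Proof. by move=> f; apply: autP => x; exact: aut_funK. Qed.
Lemma aut_mulgV : right_inverse (@aut_one G) (@aut_opp G) (@aut_mul G).
Proof. by move=> f; apply: autP => x; exact: aut_invK. Qed.

HB.instance Definition _ := isGroup.Build (aut G)
  aut_mulA aut_mul1g aut_mulg1 aut_mulVg aut_mulgV.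

Lemma conj_funK (g : G) : cancel (fun x => g * x * g^-1) (fun x => x ^ g).
Proof. by move=> x; rewrite conjgE !mulgA mulgVK mulVg mul1g. Qed.
Lemma conj_invK (g : G) : cancel (fun x => x ^ g) (fun x => g * x * g^-1).
Proof. by move=> x; rewrite conjgE mulVKg mulgK. Qed.
Lemma conj_funM (g : G) : {morph (fun x => g * x * g^-1) : x y / x * y}.
Proof. by move=> x y; rewrite !mulgA mulgVK. Qed.

Definition inner_aut (g : G) : aut G :=
  Automorphism (conj_funK g) (conj_invK g) (@conj_funM g).

Lemma inner_autM : {morph inner_aut : g h / g * h}.
Proof. by move=> g h; apply: autP => x /=; rewrite invgM !mulgA. Qed.

Lemma inner_autV g : inner_aut g^-1 = (inner_aut g)^-1.
Proof. by apply: autP => x /=; rewrite invgK conjgE mulgA. Qed.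

Lemma inner_autJ g (f : aut G) : inner_aut g ^ f = inner_aut (aut_inv f g).
Proof.
apply: autP => x; rewrite /= !aut_invM aut_funK; congr (_ * _).
apply/esym/mulg1_eq; rewrite -aut_invM mulgV.
by apply: (mulgI (aut_inv f 1)); rewrite -aut_invM !mulg1.
Qed.

Lemma inn_group_closed : group_closed [in range inner_aut].
Proof.
split=> [|f g]; rewrite !inE.
  exists 1 => //; apply: autP => x /=.
  by rewrite invg1 mulg1 mul1g.
move=> [x _ <-] [y _ <-]; exists (x * y^-1) => //.
by rewrite inner_autM inner_autV.
Qed.

Lemma inn_normal f g : range inner_aut f -> range inner_aut (f ^ g).
Proof. by move=> [x _ <-]; exists (aut_inv g x); rewrite ?inner_autJ. Qed.

Definition inn : normal_subgroup (aut G) :=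
  @NormalSubgroup _ (Subgroup inn_group_closed) inn_normal.

End AutGroup.

Definition out (G : groupType) := quotient_group (inn G).
HB.instance Definition _ G := Group.on (out G).

Section ContAut.
Variable G : topologicalGroupType.

Definition bicontinuous : pred (aut G) :=
  fun f => `[< continuous f /\ continuous (aut_inv f) >].

Record cont_aut := ContAut {
  cont_aut_aut :> aut G;
  cont_autP : bicontinuous cont_aut_aut }.

HB.instance Definition _ := [isSub for cont_aut_aut].
HB.instance Definition _ := [Choice of cont_aut by <:].

Lemma bicontinuous_closed : group_closed bicontinuous.
Proof.
rewrite /group_closed; apply: conj => [|f g].
  by apply/asboolP; apply: conj => x; exact: cvg_id.
move=> /asboolP[cf cf'] /asboolP[cg cg']; apply/asboolP; apply: conj => x.
  exact: (@continuous_comp _ _ _ (aut_inv g) f x (cg' x) (cf _)).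
exact: (@continuous_comp _ _ _ (aut_inv f) g x (cf' x) (cg _)).
Qed.

HB.instance Definition _ :=
  SubChoice_isSubGroup.Build _ _ cont_aut bicontinuous_closed.

Definition cont_inn_set : set cont_aut := [set f | carrier (inn G) (val f)].

Lemma cont_inn_group_closed : group_closed [in cont_inn_set].
Proof.
split=> [|f g]; rewrite !inE; first exact: (subgroup1 (inn G)).
move=> innf inng.
exact: (@subgroupM _ (inn G) _ _ innf (@subgroupV _ (inn G) _ inng)).
Qed.

Lemma cont_inn_normal f g : cont_inn_set f -> cont_inn_set (f ^ g).
Proof. exact: (@normal_subgroupJ _ (inn G) (val f) (val g)). Qed.

Definition cont_inn : normal_subgroup cont_aut :=
  @NormalSubgroup _ (Subgroup cont_inn_group_closed) cont_inn_normal.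

Definition small_index_set (n : nat) : set G :=
  [set x | forall H : subgroup G,
    open H -> [set: coset_space H] #<= `I_n -> carrier H x].

Lemma small_index_group_closed n : group_closed [in small_index_set n].
Proof.
split=> [|x y]; rewrite !inE; first by move=> H _ _; exact: subgroup1.
move=> Ux Uy H oH Hn.
exact: (subgroupM (Ux H oH Hn) (subgroupV (Uy H oH Hn))).
Qed.

Definition small_index (n : nat) : subgroup G :=
  Subgroup (small_index_group_closed n).

(* the permutation x U_n |-> f x U_n of G / U_n, where U_n = small_index n; it
   is well defined because U_n is characteristic *)
Definition induced (f : cont_aut) (n : nat) :
    coset_space (small_index n) -> coset_space (small_index n) :=
  fun q => \pi_(coset_space (small_index n)) (f (repr q)).

(* the topology of the inverse limit of the discrete groups Aut (G / U_n) *)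
Definition induced_topology := initial_topology
  (induced : cont_aut -> prod_topology (fun n => discrete_topology
     (coset_space (small_index n) -> coset_space (small_index n)))).

HB.instance Definition _ := Topological.copy cont_aut induced_topology.

End ContAut.

Definition cont_out (G : topologicalGroupType) :=
  quotient_topology (quotient_group (cont_inn G)).
HB.instance Definition _ G := Group.on (cont_out G).
HB.instance Definition _ G := Topological.on (cont_out G).

Record finite_index_normal (G : groupType) := FiniteIndexNormal {
  fin_normal :> normal_subgroup G;
  fin_index : finite_set [set: quotient_group fin_normal] }.

HB.instance Definition _ G := gen_eqMixin (finite_index_normal G).
HB.instance Definition _ G := gen_choiceMixin (finite_index_normal G).

(* the inverse limit of the G/N, over all normal subgroups N of finite index;
   for N `<=` M, the projection G/N -> G/M is \pi \o repr *)
Record completion (G : groupType) := Completion {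
  coord :> forall N : finite_index_normal G, quotient_group N;
  coord_compat : forall N M : finite_index_normal G, N `<=` M ->
    \pi_(quotient_group M) (repr (coord N)) = coord M }.

HB.instance Definition _ G := gen_eqMixin (completion G).
HB.instance Definition _ G := gen_choiceMixin (completion G).

Section Completion.
Variable G : groupType.
Implicit Types (N M : finite_index_normal G) (x y z : completion G).

Lemma completionP x y : (forall N, x N = y N) -> x = y.
Proof.
case: x y => [x xP] [y yP] /= xy.
have {}xy : x = y by exact: functional_extensionality_dep.
by subst y; congr Completion; exact: Prop_irrelevance.
Qed.

Lemma pi_repr N M g : N `<=` M ->
  \pi_(quotient_group M) (repr (\pi_(quotient_group N) g)) = \pi g.
Proof. by move=> NM; apply/coset_eqP/asboolP/NM; exact: quot_reprP. Qed.

Lemma mul_compat x y N M : N `<=` M ->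
  \pi_(quotient_group M) (repr (x N * y N)) = x M * y M.
Proof.
move=> NM; rewrite -(coord_compat x NM) -(coord_compat y NM) -piM.
by rewrite -[in LHS](reprK (x N)) -[in LHS](reprK (y N)) -piM pi_repr.
Qed.

Lemma inv_compat x N M : N `<=` M ->
  \pi_(quotient_group M) (repr (x N)^-1) = (x M)^-1.
Proof.
move=> NM; rewrite -(coord_compat x NM) -piV.
by rewrite -[in LHS](reprK (x N)) -piV pi_repr.
Qed.

(* the canonical homomorphism from G to its profinite completion *)
Definition to_completion (g : G) : completion G :=
  Completion (fun N M => @pi_repr N M g).

Definition completion_mul x y : completion G := Completion (@mul_compat x y).
Definition completion_inv x : completion G := Completion (@inv_compat x).

Lemma completion_mulA : associative completion_mul.
Proof. by move=> x y z; apply: completionP => N; exact: mulgA. Qed.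
Lemma completion_mul1g : left_id (to_completion 1) completion_mul.
Proof. by move=> x; apply: completionP => N; exact: mul1g. Qed.
Lemma completion_mulg1 : right_id (to_completion 1) completion_mul.
Proof. by move=> x; apply: completionP => N; exact: mulg1. Qed.
Lemma completion_mulVg :
  left_inverse (to_completion 1) completion_inv completion_mul.
Proof. by move=> x; apply: completionP => N; exact: mulVg. Qed.
Lemma completion_mulgV :
  right_inverse (to_completion 1) completion_inv completion_mul.
Proof. by move=> x; apply: completionP => N; exact: mulgV. Qed.

HB.instance Definition _ := isGroup.Build (completion G)
  completion_mulA completion_mul1g completion_mulg1
  completion_mulVg completion_mulgV.

Lemma to_completionM : {morph to_completion : g h / g * h}.
Proof. by move=> g h; apply: completionP => N; exact: piM. Qed.

(* the topology induced by the product of the discrete groups G/N *)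
Definition coord_topology := initial_topology
  (@coord G : completion G ->
     prod_topology (fun N => discrete_topology (quotient_group N))).

HB.instance Definition _ := Topological.copy (completion G) coord_topology.

Lemma near_coord x N : nbhs x [set y : completion G | y N = x N].
Proof.
pose T : finite_index_normal G -> topologicalType :=
  fun M => discrete_topology (quotient_group M).
have Nx := discrete_set1 (x N : discrete_topology (quotient_group N)).
have := @proj_continuous _ T N (coord x) _ Nx.
exact: (@initial_continuous _ (prod_topology T) (@coord G) x).
Qed.

Lemma completion_continuous (T : topologicalType) (f : T -> completion G) :
  (forall N t, nbhs t [set s | f s N = f t N]) -> continuous f.
Proof.
move=> cf; apply: continuous_comp_initial => t; apply/cvg_sup => N; move: t.
apply: continuous_comp_initial => t; apply/discrete_cvg.
exact: cf.
Qed.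

Lemma completion_mulg_continuous :
  continuous (fun p : completion G * completion G => p.1 * p.2).
Proof.
apply: completion_continuous => N [x y].
exists ([set z : completion G | z N = x N],
        [set z : completion G | z N = y N]).
  by split; exact: near_coord.
by move=> [z t] /= [zx ty]; congr (_ * _).
Qed.

Lemma completion_invg_continuous : continuous (fun x : completion G => x^-1).
Proof.
apply: completion_continuous => N x.
by apply: filterS (near_coord x N) => y yx; congr (_^-1).
Qed.

HB.instance Definition _ := Group_isTopologicalGroup.Build (completion G)
  completion_mulg_continuous completion_invg_continuous.

End Completion.

Section Extension.
Variable G : groupType.
Implicit Types (N M : finite_index_normal G) (f : aut G) (g : G).

Lemma aut1 f : f 1 = 1.
Proof. by apply: (mulgI (f 1)); rewrite -autM !mulg1. Qed.

Lemma autV f x : f x^-1 = (f x)^-1.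
Proof. by apply/esym/mulg1_eq; rewrite -autM mulgV aut1. Qed.

Lemma autJ f x y : f (x ^ y) = f x ^ f y.
Proof. by rewrite !conjgE !autM autV. Qed.

Lemma preimage_group_closed f N : group_closed [in f @^-1` N].
Proof.
split=> [|x y]; rewrite !inE /preimage /=.
  by rewrite aut1; exact: subgroup1.
by move=> Nx Ny; rewrite autM autV; apply: subgroupM => //; exact: subgroupV.
Qed.

Lemma preimage_normal f N x y :
  (f @^-1` N) x -> (f @^-1` N) (x ^ y).
Proof. by rewrite /preimage /= autJ; exact: normal_subgroupJ. Qed.

Definition preimage_normal_subgroup f N : normal_subgroup G :=
  @NormalSubgroup _ (Subgroup (preimage_group_closed f N))
    (@preimage_normal f N).

Lemma preimage_index f N :
  finite_set [set: quotient_group (preimage_normal_subgroup f N)].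
Proof.
pose h (q : quotient_group N) :=
  \pi_(quotient_group (preimage_normal_subgroup f N)) (aut_inv f (repr q)).
apply: (@sub_finite_set _ _ (h @` setT)); last exact/finite_image/fin_index.
move=> q _; exists (\pi_(quotient_group N) (f (repr q))) => //.
rewrite /h -[RHS]reprK; apply/coset_eqP/asboolP => /=.
by rewrite /preimage /= autM autV aut_invK; exact: quot_reprP.
Qed.

Definition preimage_fin f N : finite_index_normal G :=
  FiniteIndexNormal (preimage_index f N).

(* The extension of f sends (x_N)_N to the family whose component at N is the
   image of x_{f^-1 N} under the isomorphism G/(f^-1 N) -> G/N induced by f. *)
Definition extend_coord f (x : completion G) N : quotient_group N :=
  \pi_(quotient_group N) (f (repr (x (preimage_fin f N)))).

Lemma pi_aut_repr f N g :
  \pi_(quotient_group N)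
    (f (repr (\pi_(quotient_group (preimage_fin f N)) g))) =
  \pi_(quotient_group N) (f g).
Proof.
apply/coset_eqP/asboolP; rewrite -autV -autM.
exact: (@quot_reprP _ (preimage_fin f N) g).
Qed.

Lemma extend_compat f x N M : N `<=` M ->
  \pi_(quotient_group M) (repr (extend_coord f x N)) = extend_coord f x M.
Proof.
move=> NM; rewrite pi_repr //.
have fNM : preimage_fin f N `<=` preimage_fin f M by move=> z; exact: NM.
by rewrite /extend_coord -(coord_compat x fNM) pi_aut_repr.
Qed.

Definition extend_fun f (x : completion G) : completion G :=
  Completion (@extend_compat f x).

Lemma extend_funM f : {morph extend_fun f : x y / x * y}.
Proof.
move=> x y; apply: completionP => N.
rewrite [LHS]/= /extend_coord.
have -> : (extend_fun f x * extend_fun f y) N =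
  extend_coord f x N * extend_coord f y N by [].
by rewrite /extend_coord -piM -autM -(pi_aut_repr f N (_ * _)) piM !reprK.
Qed.

Lemma extend_funK f : cancel (extend_fun f) (extend_fun f^-1).
Proof.
move=> x; apply: completionP => N.
rewrite /= /extend_coord /= /extend_coord pi_aut_repr /= aut_funK.
have sub : preimage_fin f (preimage_fin f^-1 N) `<=` N.
  by move=> z; rewrite /= /preimage /= aut_funK.
exact: coord_compat sub.
Qed.

Lemma extend_funVK f : cancel (extend_fun f^-1) (extend_fun f).
Proof. by have := @extend_funK f^-1; rewrite invgK. Qed.

Lemma extend_fun_continuous f : continuous (extend_fun f).
Proof.
apply: completion_continuous => N x.
apply: filterS (near_coord x (preimage_fin f N)) => y /= yx.
by rewrite /extend_coord yx.
Qed.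

Lemma extend_funE f g :
  extend_fun f (to_completion g) = to_completion (f g).
Proof. by apply: completionP => N; exact: pi_aut_repr. Qed.

Definition extend_aut f : aut (completion G) :=
  Automorphism (@extend_funK f) (@extend_funVK f) (@extend_funM f).

Lemma extend_aut_bicontinuous f : bicontinuous (extend_aut f).
Proof. by apply/asboolP; split; exact: extend_fun_continuous. Qed.

Definition extend (f : aut G) : cont_aut (completion G) :=
  ContAut (extend_aut_bicontinuous f).

Lemma extendM : {morph extend : f h / f * h}.
Proof.
move=> f g; apply/val_inj/autP => x; apply: completionP => N.
rewrite /= /extend_coord /= /extend_coord pi_aut_repr.
have sub : preimage_fin (f * g) N `<=` preimage_fin g (preimage_fin f N) by [].
rewrite -[RHS](pi_aut_repr f N) -(coord_compat x sub).
by rewrite (pi_aut_repr g (preimage_fin f N)) pi_aut_repr.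
Qed.

Lemma extend_divg f (g : aut G) : extend (f^-1 * g) = (extend f)^-1 * extend g.
Proof. by apply: (mulgI (extend f)); rewrite -extendM !mulVKg. Qed.

Lemma extend_inner g : extend_aut (inner_aut g) = inner_aut (to_completion g).
Proof.
apply: autP => x; apply: completionP => N.
have sub : preimage_fin (inner_aut g) N `<=` N.
  move=> z Nz; rewrite -[z](conj_funK g).
  exact: (@normal_subgroupJ _ N _ g Nz).
have -> : inner_aut (to_completion g) x N =
    \pi_(quotient_group N) g * x N * (\pi_(quotient_group N) g)^-1 by [].
by rewrite -(coord_compat x sub) -piV -!piM.
Qed.

(* the homomorphism Out G -> Out (completion G) induced by extend *)
Definition out_extend (q : out G) : cont_out (completion G) :=
  \pi_(cont_out (completion G)) (extend (repr q)).

Lemma out_extend_pi f :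
  out_extend (\pi_(out G) f) = \pi_(cont_out (completion G)) (extend f).
Proof.
apply/coset_eqP/asboolP; rewrite -extend_divg.
have [g _ inng] := @quot_reprP _ (inn G) f.
by exists (to_completion g); rewrite //= -extend_inner inng.
Qed.

Lemma out_extendM : {morph out_extend : p q / p * q}.
Proof.
move=> p q; rewrite -[p]reprK -[q]reprK -(@piM _ (inn G)).
rewrite !out_extend_pi extendM.
exact: (@piM _ (cont_inn (completion G))).
Qed.

End Extension.

Definition natural_hom (G : groupType)
    (Phi : completion (out G) -> cont_out (completion G)) : Prop :=
  [/\ {morph Phi : x y / x * y}, continuous Phi
    & forall q : out G, Phi (to_completion q) = out_extend q].

(* Main.v *)
Require Import Defs.
From mathcomp Require Import fingroup perm ssralg zmodp.
From mathcomp Require Import all_boot zify all_classical.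
From mathcomp Require Import topology.

(* Write F2 = <x, y>, c = [x, y] and K n for the intersection of the kernels of
   all homomorphisms from F2 to the symmetric group of degree n. Since the K n
   are characteristic and cofinal among the finite index subgroups, an element
   of the completion of Out F2 prescribes, up to inner automorphisms, compatible
   automorphisms of the F2 / K n, hence an element of Out of the completion of
   F2. The point is injectivity, that is, the congruence subgroup property: each
   finite index normal subgroup of Out F2 contains every class that acts by an
   inner automorphism on F2 / K n, for some n.

   By Nielsen reduction, Out F2 is a finite union of translates of the group A
   generated by the twists a : y |-> y x^2 and b : x |-> x y^2, and acting
   trivially on the abelianization modulo 4 forces the translate to be trivial;
   so it suffices to treat A, the image of a free group on a, b. Both twists fix
   c. Let R be the kernel of F2 -> (Z/2)^2. Geometrically, R is the group of a
   torus minus its 2-torsion points; filling the puncture c and dividing by the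
   elliptic involution gives a sphere minus three points, whose group is free on
   a, b. The resulting map psi : R -> <a, b> kills c, sends x^2 and y^2 to a^-1
   and b^-1, and satisfies psi (w r) = w psi(r) w^-1 for every w in <a, b>.
   If w acts on F2 as conjugation by f (modulo a deep K n), then f commutes with
   w c = c, and hence f lies in R and psi f = 1, because c behaves as a free
   generator. Therefore w psi(r) w^-1 = psi (f r f^-1) = psi r for all r in R,
   so w is central, so w is trivial (all modulo a given finite quotient of
   <a, b>). *)

Set Implicit Arguments.
Unset Strict Implicit.
Unset Printing Implicit Defensive.

Local Open Scope classical_set_scope.
Local Open Scope card_scope.
Local Open Scope quotient_scope.
Local Open Scope group_scope.

(** * Free groups and their finite quotients *)

Section Morphisms.
Variables (G H : groupType) (f : G -> H).
Hypothesis fM : {morph f : x y / x * y}.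

Lemma morph_one : f 1 = 1.
Proof. by apply: (mulgI (f 1)); rewrite -fM !mulg1. Qed.

Lemma morph_inv x : f x^-1 = (f x)^-1.
Proof. by apply/esym/mulg1_eq; rewrite -fM mulgV morph_one. Qed.

Lemma morph_conj x y : f (x * y * x^-1) = f x * f y * (f x)^-1.
Proof. by rewrite !fM morph_inv. Qed.

End Morphisms.

Section FreeHom.
Variables (X : choiceType).
Implicit Types (g : free_group X) (i : X).

Definition gen i : free_group X := @FreeGroup X [:: (i, true)] isT.

Lemma free_group_ind (P : free_group X -> Prop) :
  P 1 -> (forall i g, P g -> P (gen i * g)) ->
  (forall i g, P g -> P ((gen i)^-1 * g)) -> forall g, P g.
Proof.
move=> P1 PM PV [w rw]; elim: w rw => [|[i b] w IH] rw.
  by rewrite (_ : FreeGroup rw = 1) //; exact/val_inj.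
have rw' := path_sorted rw : reduced w.
have E : push (i, b) w = (i, b) :: w.
  by case: w rw {IH rw'} => //= c w /andP[/negPf ->].
case: b rw E => rw E.
- have -> : FreeGroup rw = gen i * FreeGroup rw' by exact/val_inj.
  exact/PM/IH.
- have -> : FreeGroup rw = (gen i)^-1 * FreeGroup rw' by exact/val_inj.
  exact/PV/IH.
Qed.

Section Hom.
Variables (G : groupType) (h : X -> G).

Definition letter_val (a : X * bool) : G := if a.2 then h a.1 else (h a.1)^-1.

Definition word_val (w : seq (X * bool)) : G :=
  foldr (fun a p => letter_val a * p) 1 w.

Definition free_hom g : G := word_val (word g).

Lemma free_homE g : free_hom g = word_val (word g).
Proof. by []. Qed.

Lemma letter_val_inv a : letter_val (letter_inv a) = (letter_val a)^-1.
Proof. by case: a => i []; rewrite /letter_val //= invgK. Qed.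

Lemma word_val_push a w : word_val (push a w) = letter_val a * word_val w.
Proof.
case: w => [|b w] //=; case: ifPn => [/eqP ->|//].
by rewrite letter_val_inv mulVKg.
Qed.

Lemma free_homM : {morph free_hom : u v / u * v}.
Proof.
move=> [u ru] [v rv]; rewrite /free_hom /= {ru}.
elim: u => [|a u IH] /=; first by rewrite mul1g.
by rewrite word_val_push IH mulgA.
Qed.

Lemma free_hom1 : free_hom 1 = 1.
Proof. exact: morph_one free_homM. Qed.

Lemma free_homV g : free_hom g^-1 = (free_hom g)^-1.
Proof. exact: morph_inv free_homM _. Qed.

Lemma free_hom_gen i : free_hom (gen i) = h i.
Proof. exact: mulg1. Qed.

Lemma free_hom_unique (f : free_group X -> G) :
  {morph f : u v / u * v} -> (forall i, f (gen i) = h i) -> f =1 free_hom.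
Proof.
move=> fM fg; elim/free_group_ind => [|i g IH|i g IH].
- by rewrite (morph_one fM) free_hom1.
- by rewrite fM IH free_homM free_hom_gen fg.
- by rewrite fM IH free_homM free_homV (morph_inv fM) free_hom_gen fg.
Qed.

End Hom.

#[global] Opaque free_hom.

Lemma free_hom_ext (G : groupType) (f1 f2 : free_group X -> G) :
  {morph f1 : u v / u * v} -> {morph f2 : u v / u * v} ->
  (forall i, f1 (gen i) = f2 (gen i)) -> f1 =1 f2.
Proof.
move=> f1M f2M f12 g.
rewrite (free_hom_unique (h := fun i => f2 (gen i)) f1M f12).
by rewrite (free_hom_unique (h := fun i => f2 (gen i)) f2M).
Qed.

Lemma free_hom_comp (G H : groupType) (f : G -> H) (h : X -> G) g :
  {morph f : u v / u * v} -> f (free_hom h g) = free_hom (f \o h) g.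
Proof.
move=> fM; apply: (free_hom_unique (f := f \o free_hom h)) => [u v|i] /=.
  by rewrite free_homM fM.
by rewrite free_hom_gen.
Qed.

Lemma free_hom_id g : free_hom gen g = g.
Proof. by rewrite -(free_hom_unique (f := id)). Qed.

End FreeHom.

Lemma free_hom_aut (X : choiceType) (G : groupType) (h : X -> G)
    (f : aut (free_group X)) (g : free_group X) :
  free_hom h (f g) = free_hom (fun i => free_hom h (f (gen i))) g.
Proof.
apply: (free_hom_unique (f := free_hom h \o f)) => // u v /=.
by rewrite autM free_homM.
Qed.

Lemma coset_piP (G : groupType) (N : normal_subgroup G) (x y : G) :
  carrier N (x^-1 * y) <-> \pi_(quotient_group N) x = \pi y.
Proof.
split=> [Nxy|/coset_eqP/asboolP //].
by apply/coset_eqP/asboolP.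
Qed.

(** Cayley's theorem by right translations, because permutations compose from left to right;
    faithfulness is read off at the identity. *)
Lemma finite_group_perm (Q : groupType) : finite_set [set: Q] ->
  exists (S : finType) (r : Q -> {perm S}),
    {morph r : x y / x * y} /\ injective r.
Proof.
move=> /finite_seqP[s sT].
have sP q : q \in s by have : [set: Q] q by []; rewrite sT.
pose S := seq_sub s.
pose mulr (q : Q) (t : S) : S := SeqSub (sP (ssval t * q)).
have mulr_inj q : injective (mulr q).
  by move=> t u [] /mulIg; exact: val_inj.
exists S, (fun q => perm (@mulr_inj q)); split=> [x y|x y xy].
  by apply/perm.permP => t; rewrite permM !permE; apply/val_inj; rewrite /= mulgA.
have /perm.permP/(_ (SeqSub (sP 1))) := xy.
by rewrite !permE => -[]; rewrite !mul1g.
Qed.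

Lemma fin_index_of_map (G : groupType) (N : normal_subgroup G) (S : finType)
    (f : G -> S) : (forall x y, f x = f y -> carrier N (x^-1 * y)) ->
  finite_set [set: quotient_group N].
Proof.
move=> fN; pose k (q : quotient_group N) := f (repr q).
have k_inj : {in [set: quotient_group N] &, injective k}.
  move=> p q _ _ /fN; rewrite -{2}[p]reprK -{2}[q]reprK => pq.
  exact/coset_piP.
have := inj_card_eq k_inj; move/eq_finite_set => <-.
exact: (sub_finite_set (B := [set: S])).
Qed.

(** * Characteristic subgroups cofinal among those of finite index *)

Section PermKernel.
Variables (X : finType) (n : nat).

Definition perm_kernel_set : set (free_group X) :=
  [set g | forall h : X -> {perm 'I_n}, free_hom h g = 1].

Lemma perm_kernel_group_closed : group_closed [in perm_kernel_set].
Proof.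
split=> [|g k]; rewrite !inE; first by move=> h; rewrite free_hom1.
by move=> Kg Kk h; rewrite free_homM free_homV Kg Kk invg1 mulg1.
Qed.

Lemma perm_kernelJ g k : perm_kernel_set g -> perm_kernel_set (g ^ k).
Proof.
by move=> Kg h; rewrite conjgE !free_homM free_homV Kg mul1g mulVg.
Qed.

Definition perm_kernel_normal : normal_subgroup (free_group X) :=
  @NormalSubgroup _ (Subgroup perm_kernel_group_closed) perm_kernelJ.

Lemma perm_kernel_index : finite_set [set: quotient_group perm_kernel_normal].
Proof.
apply: (fin_index_of_map (f := fun g =>
  [ffun h : {ffun X -> {perm 'I_n}} => free_hom h g])) => g k gk h.
have := congr1 (fun u : {ffun _} => u [ffun i => h i]) gk.
have ev : free_hom [ffun i => h i] =1 free_hom h.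
  apply: free_hom_ext => [||i]; [exact: free_homM..|].
  by rewrite !free_hom_gen ffunE.
by rewrite !ffunE !ev free_homM free_homV => ->; rewrite mulVg.
Qed.

Definition perm_kernel : finite_index_normal (free_group X) :=
  FiniteIndexNormal perm_kernel_index.

Lemma perm_kernel_eqP (g k : free_group X) :
  \pi_(quotient_group perm_kernel) g = \pi k <->
  forall h : X -> {perm 'I_n}, free_hom h g = free_hom h k.
Proof.
rewrite -coset_piP; split=> [gk h|gk h].
  by have := gk h; rewrite free_homM free_homV => /mulg1_eq; rewrite invgK.
by rewrite free_homM free_homV gk mulVg.
Qed.

Section Embedding.
Variables (S : finType) (Sn : #|S| <= n).

Let emb (s : S) : 'I_n := widen_ord Sn (enum_rank s).

Let emb_inj : injective emb.
Proof. by move=> s t [] /val_inj/enum_rank_inj. Qed.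

Let ext_fun (p : {perm S}) (j : 'I_n) : 'I_n :=
  if [pick s | emb s == j] is Some s then emb (p s) else j.

Let ext_fun_emb p s : ext_fun p (emb s) = emb (p s).
Proof.
rewrite /ext_fun; case: pickP => [t /eqP/emb_inj -> //|/(_ s)].
by rewrite eqxx.
Qed.

Let ext_fun_out p j : (forall s, emb s != j) -> ext_fun p j = j.
Proof.
by move=> jS; rewrite /ext_fun; case: pickP => // s; rewrite (negPf (jS s)).
Qed.

Let ext_funM p q j : ext_fun (p * q) j = ext_fun q (ext_fun p j).
Proof.
have [[s <-]|jS] := pselect (exists s, emb s = j).
  by rewrite !ext_fun_emb permM.
have jS' s : emb s != j by apply/eqP => sj; apply: jS; exists s.
by rewrite !ext_fun_out.
Qed.

Let ext_fun_inj p : injective (ext_fun p).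
Proof.
apply: (can_inj (g := ext_fun p^-1)) => j; rewrite -ext_funM mulgV.
by rewrite /ext_fun; case: pickP => // s /eqP; rewrite perm1.
Qed.

Let ext p := perm (@ext_fun_inj p).

(** An action on at most [n] points extends to ['I_n] by fixing the points outside the image of
    [emb]. *)
Lemma perm_kernel_act (h : X -> {perm S}) (g : free_group X) :
  carrier perm_kernel g -> free_hom h g = 1.
Proof.
move=> Kg; have extM : {morph ext : p q / p * q}.
  by move=> p q; apply/perm.permP => j; rewrite permM !permE ext_funM.
have := Kg (ext \o h); rewrite -free_hom_comp // => E.
apply/perm.permP => s; apply: emb_inj; rewrite -ext_fun_emb perm1.
by have /perm.permP/(_ (emb s)) := E; rewrite permE perm1.
Qed.

Lemma perm_kernel_act_eq (h : X -> {perm S}) (g k : free_group X) :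
  carrier perm_kernel (g^-1 * k) -> free_hom h g = free_hom h k.
Proof.
move=> /(perm_kernel_act h); rewrite free_homM free_homV.
by move=> /mulg1_eq; rewrite invgK.
Qed.

End Embedding.

(** An action on [n] points composed with [f] is another such action, so the kernel is
    characteristic. *)
Lemma perm_kernel_aut (f : aut (free_group X)) (g : free_group X) :
  carrier perm_kernel g -> carrier perm_kernel (f g).
Proof. by move=> Kg h; rewrite free_hom_aut Kg. Qed.

End PermKernel.

Lemma perm_kernel_mono (X : finType) m n : m <= n ->
  perm_kernel X n `<=` perm_kernel X m.
Proof.
move=> mn g Kg h; apply: (perm_kernel_act (n := n)) Kg.
by rewrite card_ord.
Qed.

(** By Cayley's theorem the quotient by [N] acts faithfully on a finite set, whose size serves as
    [n]. *)
Lemma perm_kernel_sub (X : finType) (N : finite_index_normal (free_group X)) :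
  exists n, perm_kernel X n `<=` N.
Proof.
have [S [r [rM r_inj]]] := finite_group_perm (@fin_index _ N).
exists #|S| => g /(perm_kernel_act (leqnn _)).
move=> /(_ (fun i => r (\pi_(quotient_group N) (gen i)))) rg.
have : r (\pi g) = r 1.
  rewrite (morph_one rM) -rg.
  apply: (free_hom_unique (f := r \o \pi_(quotient_group N))) => // u v /=.
  by rewrite piM rM.
move=> /r_inj/esym/coset_piP.
by rewrite invg1 mul1g.
Qed.

Definition pair2 (T : Type) (a b : T) (i : 'I_2) : T := if i == ord0 then a else b.

Lemma forall_ord2 (P : 'I_2 -> Prop) : P ord0 -> P ord_max -> forall i, P i.
Proof.
move=> P0 P1 [[|[|//]] lti].
  by rewrite (_ : Ordinal lti = ord0) //; exact/val_inj.
by rewrite (_ : Ordinal lti = ord_max) //; exact/val_inj.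
Qed.

(* The extension of a permutation action by Z/3 in which the generator i adds
   l i s to the new coordinate when it leaves s. *)
Section LabelExtension.
Variables (S : finType) (h : 'I_2 -> {perm S}) (l : 'I_2 -> S -> 'I_3).

Import GRing.Theory.

Definition label_fun (i : 'I_2) (p : S * 'I_3) : S * 'I_3 :=
  (h i p.1, (p.2 + l i p.1)%R).

Lemma label_fun_inj i : injective (label_fun i).
Proof.
move=> [s u] [t v] E; have /perm_inj /= st := congr1 fst E.
by have := congr1 snd E; rewrite /= st => /addIr ->.
Qed.

Definition label_perm i : {perm S * 'I_3} := perm (@label_fun_inj i).

Definition label (g : F2) (s : S) : 'I_3 := (free_hom label_perm g (s, 0%R)).2.

Lemma label_permE g s v :
  free_hom label_perm g (s, v) = (free_hom h g s, (v + label g s)%R).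
Proof.
rewrite /label; elim/free_group_ind: g s v => [|i g IH|i g IH] s v.
- by rewrite !free_hom1 !perm1 addr0.
- rewrite !free_homM !free_hom_gen !permM !permE /label_fun /= add0r.
  by rewrite (IH _ (v + l i s)%R) (IH _ (l i s)) addrA.
- rewrite !free_homM !free_homV !free_hom_gen !permM.
  have E t u : (label_perm i)^-1 (t, u) = ((h i)^-1 t, (u - l i ((h i)^-1%g t))%R).
    by apply: (canLR (permK _)); rewrite permE /label_fun /= permKV subrK.
  by rewrite !E sub0r (IH _ (v - _)%R) (IH _ (- _)%R) addrA.
Qed.

Lemma labelM g k s : label (g * k) s = (label g s + label k (free_hom h g s))%R.
Proof. by rewrite /label free_homM permM label_permE add0r label_permE. Qed.

Lemma label1 s : label 1 s = 0%R.
Proof. by rewrite /label free_hom1 perm1. Qed.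

Lemma label_gen i s : label (gen i) s = l i s.
Proof. by rewrite /label free_hom_gen permE /= add0r. Qed.

Lemma labelV g s : label g^-1 s = (- label g ((free_hom h g)^-1%g s))%R.
Proof.
apply/eqP; rewrite -addr_eq0 addrC.
have := labelM g g^-1 ((free_hom h g)^-1 s).
by rewrite mulgV label1 permKV => <-.
Qed.

(** As [k] fixes [s], the two orders of composition add [label g s + label k (g s)] and
    [label k s + label g s] to the last coordinate. *)
Lemma label_commute g k s :
  commute (free_hom label_perm g) (free_hom label_perm k) ->
  free_hom h k s = s -> label k (free_hom h g s) = label k s.
Proof.
move=> gk ks; have /perm.permP/(_ (s, 0%R)) := gk.
rewrite !permM !label_permE ks !add0r => /(congr1 snd) /=.
by rewrite [RHS]addrC => /addrI.
Qed.

End LabelExtension.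

(** * The congruence property of the twists *)

Definition F2x : F2 := gen ord0.
Definition F2y : F2 := gen ord_max.

Definition F2_endo (u v : F2) : F2 -> F2 := free_hom (pair2 u v).

Lemma F2_endoM u v : {morph F2_endo u v : g k / g * k}.
Proof. exact: free_homM. Qed.
Lemma F2_endoV u v g : F2_endo u v g^-1 = (F2_endo u v g)^-1.
Proof. exact: free_homV. Qed.
Lemma F2_endo_x u v : F2_endo u v F2x = u.
Proof. exact: free_hom_gen. Qed.
Lemma F2_endo_y u v : F2_endo u v F2y = v.
Proof. exact: free_hom_gen. Qed.

Definition F2_endoE := (F2_endo_x, F2_endo_y, F2_endoM, F2_endoV).

Lemma F2_morph_ext (G : groupType) (f k : F2 -> G) :
  {morph f : u v / u * v} -> {morph k : u v / u * v} ->
  f F2x = k F2x -> f F2y = k F2y -> f =1 k.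
Proof.
by move=> fM kM fx fy; apply: free_hom_ext => //; exact: forall_ord2.
Qed.

Lemma F2_endo_can u v u' v' :
  F2_endo u' v' u = F2x -> F2_endo u' v' v = F2y ->
  cancel (F2_endo u v) (F2_endo u' v').
Proof.
move=> ux vy; apply: (F2_morph_ext (k := id)) => [g k|//||] /=.
- by rewrite !F2_endoM.
- by rewrite F2_endo_x.
- by rewrite F2_endo_y.
Qed.

Section F2Aut.
Variables u v u' v' : F2.
Hypothesis uvP : [/\ F2_endo u' v' u = F2x, F2_endo u' v' v = F2y,
  F2_endo u v u' = F2x & F2_endo u v v' = F2y].

Fact F2_aut_funK : cancel (F2_endo u v) (F2_endo u' v').
Proof. by have [ux vy _ _] := uvP; exact: F2_endo_can. Qed.
Fact F2_aut_invK : cancel (F2_endo u' v') (F2_endo u v).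
Proof. by have [_ _ ux vy] := uvP; exact: F2_endo_can. Qed.

Definition F2_aut : aut F2 := Automorphism F2_aut_funK F2_aut_invK (F2_endoM u v).

End F2Aut.

Fact twist_xP : [/\ F2_endo F2x (F2y * F2x^-1 * F2x^-1) F2x = F2x,
  F2_endo F2x (F2y * F2x^-1 * F2x^-1) (F2y * F2x * F2x) = F2y,
  F2_endo F2x (F2y * F2x * F2x) F2x = F2x &
  F2_endo F2x (F2y * F2x * F2x) (F2y * F2x^-1 * F2x^-1) = F2y].
Proof. by rewrite !F2_endoE !mulgVK !mulgK. Qed.
Definition twist_x : aut F2 := F2_aut twist_xP.

Fact twist_yP : [/\ F2_endo (F2x * F2y^-1 * F2y^-1) F2y (F2x * F2y * F2y) = F2x,
  F2_endo (F2x * F2y^-1 * F2y^-1) F2y F2y = F2y,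
  F2_endo (F2x * F2y * F2y) F2y (F2x * F2y^-1 * F2y^-1) = F2x &
  F2_endo (F2x * F2y * F2y) F2y F2y = F2y].
Proof. by rewrite !F2_endoE !mulgVK !mulgK. Qed.
Definition twist_y : aut F2 := F2_aut twist_yP.

Lemma twist_xE g : twist_x g = F2_endo F2x (F2y * F2x * F2x) g.
Proof. by []. Qed.
Lemma twist_yE g : twist_y g = F2_endo (F2x * F2y * F2y) F2y g.
Proof. by []. Qed.

Definition twist : F2 -> aut F2 := free_hom (pair2 twist_x twist_y).

Lemma twistM : {morph twist : u v / u * v}.
Proof. exact: free_homM. Qed.

Definition F2c : F2 := F2x * F2y * F2x^-1 * F2y^-1.

Lemma aut_mulE (G : groupType) (f g : aut G) x : (f * g) x = f (g x).
Proof. by []. Qed.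

Lemma aut_invE (G : groupType) (f : aut G) x : f^-1 x = aut_inv f x.
Proof. by []. Qed.

Lemma twist_gen i : twist (gen i) = pair2 twist_x twist_y i.
Proof. exact: free_hom_gen. Qed.

Lemma twist_c w : twist w F2c = F2c.
Proof.
have gen_c i : twist (gen i) F2c = F2c.
  rewrite twist_gen; elim/forall_ord2: i; rewrite /pair2 /=.
    by rewrite /F2c ?twist_xE !F2_endoE !invgM !mulgA !mulgK.
  by rewrite /F2c ?twist_yE !F2_endoE !invgM !mulgA !mulgK.
elim/free_group_ind: w => [|i w IH|i w IH].
- by rewrite /twist free_hom1.
- by rewrite twistM aut_mulE IH.
- rewrite twistM aut_mulE IH /twist free_homV aut_invE.
  by apply: (canLR (aut_funK _)); rewrite gen_c.
Qed.

Lemma commute_inj_morph (G H : groupType) (f : G -> H) (x y : G) :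
  {morph f : u v / u * v} -> commute x y -> commute (f x) (f y).
Proof. by move=> fM; rewrite /commute -!fM => ->. Qed.

(* The action of F2 induced from R along R -> <a, b> acting by t: its underlying
   set is (Z/2)^2 * T, R is the stabilizer of (false, false), and the
   coefficients are the values of psi on the edges of the Schreier graph of R.
   Each twist intertwines it with itself, through cover_twist. *)
Section CoverRep.
Variables (T : finType) (t : 'I_2 -> {perm T}).

Let a := t ord0.
Let b := t ord_max.

Let cover := (bool * bool * T)%type.

Let move_x (p : cover) : cover :=
  let: (i, j, s) := p in
  (~~ i, j, (match i, j with
             | false, false => b^-1
             | true, false => b * a^-1
             | false, true => 1
             | true, true => a
             end) s).

Let move_y (p : cover) : cover :=
  let: (i, j, s) := p in
  (i, ~~ j, (match i, j with
             | false, false => 1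
             | false, true => b^-1
             | true, true => 1
             | true, false => b
             end) s).

Let twist_fun_x (p : cover) : cover :=
  let: (i, j, s) := p in
  (i, j, (match i, j with
          | false, false => a
          | true, false => b * a * b^-1
          | _, true => 1
          end) s).

Let twist_fun_y (p : cover) : cover :=
  let: (i, j, s) := p in (i, j, (if i then 1 else b) s).

Let move_x_inj : injective move_x.
Proof.
by move=> [[i j] s] [[k l] u] [] /(can_inj negbK) <- <-; case: i; case: j => /perm_inj ->.
Qed.
Let move_y_inj : injective move_y.
Proof.
by move=> [[i j] s] [[k l] u] [] <- /(can_inj negbK) <-; case: i; case: j => /perm_inj ->.
Qed.
Let twist_fun_x_inj : injective twist_fun_x.
Proof.
by move=> [[i j] s] [[k l] u] [] <- <-; case: i; case: j => /perm_inj ->.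
Qed.
Let twist_fun_y_inj : injective twist_fun_y.
Proof.
by move=> [[i j] s] [[k l] u] [] <- <-; case: i => /perm_inj ->.
Qed.

Definition cover_gen : 'I_2 -> {perm cover} :=
  pair2 (perm move_x_inj) (perm move_y_inj).

Definition cover_twist : 'I_2 -> {perm cover} :=
  pair2 (perm twist_fun_x_inj) (perm twist_fun_y_inj).

Local Notation rep := (free_hom cover_gen).
Local Notation tw := (free_hom cover_twist).

Let cover_gen_xE i j s : cover_gen ord0 (i, j, s) = move_x (i, j, s).
Proof. by rewrite permE. Qed.
Let cover_gen_yE i j s : cover_gen ord_max (i, j, s) = move_y (i, j, s).
Proof. by rewrite permE. Qed.
Let cover_twist_xE i j s : cover_twist ord0 (i, j, s) = twist_fun_x (i, j, s).
Proof. by rewrite permE. Qed.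
Let cover_twist_yE i j s : cover_twist ord_max (i, j, s) = twist_fun_y (i, j, s).
Proof. by rewrite permE. Qed.
Let coverE := (cover_gen_xE, cover_gen_yE, cover_twist_xE, cover_twist_yE).

Lemma cover_twist_gen i g :
  rep (twist (gen i) g) * cover_twist i = cover_twist i * rep g.
Proof.
apply: (mulIg (cover_twist i)^-1); rewrite mulgK.
have conjM : {morph (fun g => cover_twist i * rep g * (cover_twist i)^-1) :
    g k / g * k}.
  by move=> u v; rewrite free_homM !mulgA mulgVK.
apply: (F2_morph_ext (f := fun g => rep (twist (gen i) g)) _ conjM) g => [u v||].
- by rewrite autM free_homM.
- apply: (mulIg (cover_twist i)); rewrite mulgVK twist_gen.
  elim/forall_ord2: i {conjM} => /=; rewrite ?twist_xE ?twist_yE F2_endo_x;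
  rewrite ?free_homM !free_hom_gen;
  apply/perm.permP => -[[i j] s]; rewrite !permM;
  by case: i; case: j; rewrite !coverE /= ?coverE /= ?coverE /= ?coverE /= ?perm1
    ?permM ?perm1 ?permM ?permKV ?permK ?permKV ?permK.
- apply: (mulIg (cover_twist i)); rewrite mulgVK twist_gen.
  elim/forall_ord2: i {conjM} => /=; rewrite ?twist_xE ?twist_yE F2_endo_y;
  rewrite ?free_homM !free_hom_gen;
  apply/perm.permP => -[[i j] s]; rewrite !permM;
  by case: i; case: j; rewrite !coverE /= ?coverE /= ?coverE /= ?coverE /= ?perm1
    ?permM ?perm1 ?permM ?permKV ?permK ?permKV ?permK.
Qed.

(** This is the equivariance psi (w r) = w psi(r) w^-1, stated for the induced action. *)
Lemma cover_twistE w g : rep (twist w g) = tw w * rep g * (tw w)^-1.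
Proof.
elim/free_group_ind: w g => [|i w IH|i w IH] g.
- by rewrite /twist !free_hom1 invg1 mul1g mulg1.
- rewrite twistM aut_mulE !free_homM free_hom_gen invgM !mulgA.
  apply: (mulIg (cover_twist i)); rewrite mulgVK cover_twist_gen IH.
  by rewrite !mulgA.
- have := cover_twist_gen i (twist (gen i)^-1 (twist w g)).
  rewrite {1 2}/twist free_homV aut_invE aut_invK -/(twist (gen i)) => E.
  rewrite twistM aut_mulE !free_homM !free_homV free_hom_gen invgM invgK !mulgA.
  rewrite {1}/twist free_homV aut_invE.
  by apply: (mulgI (cover_twist i)); rewrite -E IH !mulgA mulgV mul1g.
Qed.

Lemma cover_twist_base w s : tw w (false, false, s) = (false, false, free_hom t w s).
Proof.
elim/free_group_ind: w s => [|i w IH|i w IH] s.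
- by rewrite !free_hom1 !perm1.
- rewrite !free_homM !free_hom_gen !permM -IH; congr (tw w _).
  by elim/forall_ord2: i; rewrite coverE.
- rewrite !free_homM !free_homV !free_hom_gen !permM -IH; congr (tw w _).
  apply: (canLR (permK _)).
  by elim/forall_ord2: i; rewrite coverE /= permKV.
Qed.

Lemma cover_xx s : rep (F2x * F2x) (false, false, s) = (false, false, a^-1 s).
Proof.
by rewrite free_homM !free_hom_gen permM coverE /= ?coverE /= permM permKV.
Qed.

Lemma cover_yy s : rep (F2y * F2y) (false, false, s) = (false, false, b^-1 s).
Proof.
by rewrite free_homM !free_hom_gen permM coverE /= ?coverE /= perm1.
Qed.

Lemma cover_c s : rep F2c (false, false, s) = (false, false, s).
Proof.
rewrite /F2c !free_homM !free_homV !free_hom_gen !permM.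
rewrite coverE /= coverE /=.
have -> : (cover_gen ord0)^-1 (true, true, b (b^-1 s)) = (false, true, s).
  by apply: (canLR (permK _)); rewrite coverE /= perm1 permKV.
by apply: (canLR (permK _)); rewrite coverE /= perm1.
Qed.

Section Base.
Variable s0 : T.

Let base : cover := (false, false, s0).

Definition base_label (i : 'I_2) (p : cover) : 'I_3 :=
  if (i == ord0) && (p == base) then Zp1 else Zp0.

Local Notation lab := (label cover_gen base_label).

(* Only the edge x leaving base is labelled; the loop c based at p runs along it
   forwards if p = base, and backwards in its third step for one other p. As
   1 != -1 in Z/3, this singles out base. *)
Lemma label_c p : lab F2c p = ((if p == base then Zp1 else Zp0) -
  (if rep (F2x * F2y * F2x^-1)%g p == base then Zp1 else Zp0))%R.
Proof.
rewrite /F2c !labelM !labelV !label_gen /base_label /=.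
rewrite -[Zp0]/(0%R : 'I_3) GRing.oppr0 !GRing.addr0.
by rewrite !free_homM !free_homV !free_hom_gen !permM.
Qed.

Lemma label_c_base : lab F2c base = Zp1.
Proof.
rewrite label_c eqxx !free_homM !free_homV !free_hom_gen !permM coverE /= ?coverE /=.
have -> : (cover_gen ord0)^-1 (true, true, b (b^-1 s0)) = (false, true, s0).
  by apply: (canLR (permK _)); rewrite coverE /= perm1 permKV.
by rewrite GRing.subr0.
Qed.

Lemma label_c_eq1 p : lab F2c p = Zp1 -> p = base.
Proof.
rewrite label_c; case: eqP => // _.
by case: ifP => _ /eqP; rewrite -val_eqE.
Qed.

(** The loop [F2c] has the same label at the image of [base] under [f] as at [base], and this label
    occurs only at [base]. Thus [f] lies in R and psi f fixes [s0]. *)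
Lemma commute_c_base f :
  commute (free_hom (label_perm cover_gen base_label) f)
    (free_hom (label_perm cover_gen base_label) F2c) ->
  rep f base = base.
Proof.
move=> fc; apply: label_c_eq1.
by rewrite (label_commute fc (cover_c s0)) label_c_base.
Qed.

End Base.
End CoverRep.

(** Since [twist w] fixes [F2c], the element [f] commutes with [F2c] on the labelled cover, so it
    fixes every point of the base sheet. Conjugation by [f] then leaves the action of [F2x * F2x]
    and [F2y * F2y] on that sheet unchanged, whereas [twist w] conjugates it by [w]. *)
Lemma twist_inner_commute (T : finType) (t : 'I_2 -> {perm T}) (n : nat) (w f : F2) :
  #|{: bool * bool * T * 'I_3}| <= n ->
  (forall g, carrier (perm_kernel 'I_2 n) ((twist w g)^-1 * (f * g * f^-1))) ->
  forall i, commute (free_hom t w) (t i).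
Proof.
move=> Tn wf.
have T'n : #|{: bool * bool * T}| <= n.
  apply: leq_trans Tn; rewrite [X in _ <= X]card_prod card_ord.
  by rewrite leq_pmulr.
have fbase s : free_hom (cover_gen t) f (false, false, s) = (false, false, s).
  apply: commute_c_base.
  have := wf F2c; rewrite twist_c => /(perm_kernel_act_eq Tn).
  move=> /(_ (label_perm (cover_gen t) (base_label s))).
  by rewrite (free_homM _ (f * _)) (free_homM _ f) free_homV /commute => {2}->; rewrite mulgVK.
have key u i : (forall s, free_hom (cover_gen t) u (false, false, s) =
    (false, false, (t i)^-1 s)) -> commute (free_hom t w) (t i).
  move=> uE; rewrite -[t i]invgK; apply: commuteV.
  have /(perm_kernel_act_eq T'n (cover_gen t)) := wf u.
  rewrite cover_twistE !free_homM free_homV => E.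
  have {}E : free_hom (cover_twist t) w * free_hom (cover_gen t) u =
    (free_hom (cover_gen t) f * free_hom (cover_gen t) u *
    (free_hom (cover_gen t) f)^-1) * free_hom (cover_twist t) w.
    by rewrite -E mulgVK.
  apply/perm.permP => s; have /perm.permP/(_ (false, false, s)) := E.
  rewrite !permM fbase cover_twist_base !uE.
  rewrite (canLR (permK _) (esym (fbase _))) cover_twist_base.
  by case.
elim/forall_ord2; first exact: (key _ ord0 (cover_xx t)).
exact: (key _ ord_max (cover_yy t)).
Qed.

Lemma free_homX (X : choiceType) (G : groupType) (h : X -> G) (i : X) k :
  free_hom h (gen i ^+ k) = h i ^+ k.
Proof.
elim: k => [|k IH]; first by rewrite !expg0 free_hom1.
by rewrite !expgS free_homM IH free_hom_gen.
Qed.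

(* Labelling a single edge of the cycle of s0 under i distinguishes this cycle
   from all others, so that it is preserved by everything that commutes with i. *)
Lemma commute_orbit (S : finType) (h : 'I_2 -> {perm S}) (s0 : S) (i : 'I_2) :
  exists (T : finType) (t : 'I_2 -> {perm T}), forall w,
    commute (free_hom t w) (t i) -> exists k, (h i ^+ k) (free_hom h w s0) = s0.
Proof.
pose l (j : 'I_2) s : 'I_3 := if (j == i) && (s == s0) then Zp1 else Zp0.
exists (S * 'I_3)%type, (label_perm h l) => w wi.
have labS k s : label h l (gen i ^+ k.+1) s =
    (label h l (gen i ^+ k)%g s + (if (h i ^+ k)%g s == s0 then Zp1 else Zp0))%R.
  by rewrite expgSr labelM label_gen free_homX /l eqxx.
have lab0 s : label h l (gen i ^+ 0) s = 0%R by rewrite label1.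
have ex_e : exists e, (0 < e) && ((h i ^+ e) s0 == s0).
  by exists #[h i]; rewrite fingroup.order_gt0 expg_order perm1 eqxx.
case: (ex_minnP ex_e) => e /andP[e_gt0 /eqP he] e_min.
have lab_s0 : label h l (gen i ^+ e) s0 = Zp1.
  have lab1 k : k < e -> label h l (gen i ^+ k.+1) s0 = Zp1.
    elim: k => [|k IH] ke.
      by rewrite labS lab0 expg0 perm1 eqxx GRing.add0r.
    rewrite labS IH; last exact: ltnW.
    case: eqP => [hk|_]; last by rewrite GRing.addr0.
    by have := e_min k.+1; rewrite hk eqxx => /(_ isT); rewrite leqNgt ke.
  by move: e_gt0 lab1; case: (e) => // e' _; apply.
(* Off the cycle of [s0] no labelled edge is met, so the label of [gen i ^+ e] would be 0 there,
   against its value 1 at [s0]. *)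
have [//|no_k] := pselect (exists k, (h i ^+ k) (free_hom h w s0) = s0).
have lab_w k : label h l (gen i ^+ k) (free_hom h w s0) = 0%R.
  elim: k => [|k IH]; first exact: lab0.
  rewrite labS IH; case: eqP => [hk|_]; last exact: GRing.addr0.
  by case: no_k; exists k.
have := @label_commute S h l w (gen i ^+ e) s0.
rewrite !free_homX lab_w lab_s0 => /(_ (commuteX _ wi) he).
by move=> /(congr1 val).
Qed.

(* The last two coordinates make the orbits of (1, 1, 1) under the two generators
   meet in a single point. *)
Section TripleRep.
Variables (G : finGroupType) (h : 'I_2 -> G).

Let other (j i : 'I_2) : G := if i == j then h i else 1.

Let triple_fun (i : 'I_2) (p : G * G * G) : G * G * G :=
  let: (s, u, v) := p in (s * h i, u * other ord0 i, v * other ord_max i).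

Let triple_fun_inj i : injective (triple_fun i).
Proof.
by move=> [[s u] v] [[s' u'] v'] [] /mulIg -> /mulIg -> /mulIg ->.
Qed.

Definition triple_perm (i : 'I_2) : {perm G * G * G} := perm (@triple_fun_inj i).

Lemma triple_permX i k s u v : (triple_perm i ^+ k) (s, u, v) =
  (s * h i ^+ k, u * other ord0 i ^+ k, v * other ord_max i ^+ k).
Proof.
elim: k => [|k IH]; first by rewrite !expg0 perm1 !mulg1.
by rewrite !expgSr permM IH permE /= !mulgA.
Qed.

Lemma triple_perm_fst w p :
  (free_hom triple_perm w p).1.1 = p.1.1 * free_hom h w.
Proof.
elim/free_group_ind: w p => [|i w IH|i w IH] p.
- by rewrite !free_hom1 perm1 mulg1.
- rewrite !free_homM permM IH !free_hom_gen permE.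
  by case: p => [[s u] v] /=; rewrite mulgA.
- rewrite !free_homM permM IH !free_homV !free_hom_gen mulgA.
  set q := (triple_perm i)^-1 p; have -> : p = triple_perm i q by rewrite permKV.
  by rewrite permE; case: q => [[s u] v] /=; rewrite mulgK.
Qed.

(** The return under [ord_max] does not move the second coordinate, which is therefore 1; the return
    under [ord0] then gives [h ord0 ^+ k = 1], so the first coordinate, the value of [w], is 1
    too. *)
Lemma triple_orbits w k l :
  (triple_perm ord0 ^+ k) (free_hom triple_perm w (1, 1, 1)) = (1, 1, 1) ->
  (triple_perm ord_max ^+ l) (free_hom triple_perm w (1, 1, 1)) = (1, 1, 1) ->
  free_hom h w = 1.
Proof.
have := triple_perm_fst w (1, 1, 1); rewrite mul1g.
case: (free_hom triple_perm w _) => [[s u] v] /= <-.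
rewrite !triple_permX /other /= !expg1n !mulg1.
by move=> [s1 u1 _] [_ u_1 _]; move: u1 s1; rewrite u_1 mul1g => ->; rewrite mulg1.
Qed.

End TripleRep.

(** A finite form of the triviality of the centre of a free group: [w] commutes with each generator
    in a suitable action, which puts the image of (1, 1, 1) under [w] on both cycles through that
    point. *)
Lemma twist_congruence (G : finGroupType) (h : 'I_2 -> G) : exists n, forall w f,
  (forall g, carrier (perm_kernel 'I_2 n) ((twist w g)^-1 * (f * g * f^-1))) ->
  free_hom h w = 1.
Proof.
have [T0 [t0 t0P]] := commute_orbit (triple_perm h) (1, 1, 1) ord0.
have [T1 [t1 t1P]] := commute_orbit (triple_perm h) (1, 1, 1) ord_max.
pose N (T : finType) := #|{: bool * bool * T * 'I_3}|.
exists (maxn (N T0) (N T1)) => w f wf.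
have [k k1] := t0P _ (twist_inner_commute t0 (leq_maxl _ _) wf ord0).
have [l l1] := t1P _ (twist_inner_commute t1 (leq_maxr _ _) wf ord_max).
exact: triple_orbits k1 l1.
Qed.

(** * Generators of the outer automorphism group of [F2] *)

Local Notation cl f := (\pi_(out F2) f).

Fact F2_swapP : [/\ F2_endo F2y F2x F2y = F2x, F2_endo F2y F2x F2x = F2y,
  F2_endo F2y F2x F2y = F2x & F2_endo F2y F2x F2x = F2y].
Proof. by rewrite !F2_endoE. Qed.
Definition F2_swap : aut F2 := F2_aut F2_swapP.

Fact F2_signP : [/\ F2_endo F2x^-1 F2y F2x^-1 = F2x, F2_endo F2x^-1 F2y F2y = F2y,
  F2_endo F2x^-1 F2y F2x^-1 = F2x & F2_endo F2x^-1 F2y F2y = F2y].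
Proof. by rewrite !F2_endoE invgK. Qed.
Definition F2_sign : aut F2 := F2_aut F2_signP.

Fact F2_shearP : [/\ F2_endo (F2x * F2y^-1) F2y (F2x * F2y) = F2x,
  F2_endo (F2x * F2y^-1) F2y F2y = F2y,
  F2_endo (F2x * F2y) F2y (F2x * F2y^-1) = F2x & F2_endo (F2x * F2y) F2y F2y = F2y].
Proof. by rewrite !F2_endoE mulgVK mulgK. Qed.
Definition F2_shear : aut F2 := F2_aut F2_shearP.

Lemma out_eqP (G : groupType) (f k : aut G) :
  \pi_(out G) f = \pi k <-> exists g, k = f * inner_aut g.
Proof.
rewrite -(coset_piP (inn G)); split=> [[g _ gE]|[g ->]].
  by exists g; rewrite gE mulVKg.
by exists g => //; rewrite mulKg.
Qed.

Lemma out_inner (G : groupType) (f : aut G) g :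
  \pi_(out G) (inner_aut g * f) = \pi f.
Proof.
apply/esym/out_eqP; exists (aut_inv f g); apply: autP => x.
by rewrite !aut_mulE /= !autM autV !aut_invK.
Qed.

Lemma F2_out_eq (f k : aut F2) (g : F2) :
  f F2x = g * k F2x * g^-1 -> f F2y = g * k F2y * g^-1 -> cl f = cl k.
Proof.
move=> fx fy; rewrite -(out_inner k g); congr (\pi_(out F2) _); apply: autP.
by apply: F2_morph_ext => //; exact: autM.
Qed.

Lemma clM f k : cl (f * k) = cl f * cl k.
Proof. exact: piM. Qed.

(** * Nielsen reduction *)

Section CommonPrefix.
Variable T : eqType.
Implicit Types u v w : seq T.

Fixpoint lcp u v : nat :=
  match u, v with
  | a :: u', b :: v' => if a == b then (lcp u' v').+1 else 0
  | _, _ => 0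
  end.

Lemma lcp_neq a b u v : a != b -> lcp (a :: u) (b :: v) = 0.
Proof. by rewrite /=; case: eqP. Qed.

Lemma lcpC u v : lcp u v = lcp v u.
Proof. by elim: u v => [|a u IH] [|b v] //=; rewrite eq_sym IH. Qed.

Lemma lcpp u : lcp u u = size u.
Proof. by elim: u => //= a u ->; rewrite eqxx. Qed.

Lemma lcp_size u v : lcp u v <= size u.
Proof. by elim: u v => [|a u IH] [|b v] //=; case: ifP => // _; exact: IH. Qed.

Lemma lcp_ultra u v w : minn (lcp u v) (lcp v w) <= lcp u w.
Proof.
elim: u v w => [|a u IH] [|b v] [|c w] //=; rewrite ?min0n ?minn0 //.
case: eqP => [->|_]; last by rewrite min0n.
by case: eqP => _; rewrite ?minn0 // minnSS ltnS.
Qed.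

Lemma lcp_take k u v : k <= lcp u v -> take k u = take k v.
Proof.
elim: u v k => [|a u IH] [|b v] [|k] //=; case: eqP => // ->.
by rewrite ltnS => /IH ->.
Qed.

Lemma lcp_take_self k u : lcp (take k u) u = minn k (size u).
Proof.
elim: u k => [|a u IH] [|k] //=.
by rewrite eqxx IH minnSS.
Qed.

End CommonPrefix.

Section Length.
Variable X : choiceType.
Implicit Types g h : free_group X.

Definition len g := size (word g).

(** This counts the letters of each factor that cancel in [g^-1 * h]; the cancellation in [g * h] is
    thus [cancel_len g^-1 h]. *)
Definition cancel_len g h := lcp (word g) (word h).

Lemma len_eq0 g : (len g == 0) = (g == 1).
Proof. by rewrite -(inj_eq val_inj) -size_eq0. Qed.

Lemma lenV g : len g^-1 = len g.
Proof. by rewrite /len /= /word_inv size_rev size_map. Qed.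

Lemma cancel_lenC g h : cancel_len g h = cancel_len h g.
Proof. exact: lcpC. Qed.

Lemma cancel_len_self g : cancel_len g g = len g.
Proof. exact: lcpp. Qed.

Lemma cancel_len_le g h : cancel_len g h <= len g.
Proof. exact: lcp_size. Qed.

Lemma cancel_len_ultra g h (k : free_group X) :
  minn (cancel_len g h) (cancel_len h k) <= cancel_len g k.
Proof. exact: lcp_ultra. Qed.

Lemma word_mulV_size (u v : seq (X * bool)) : reduced u -> reduced v ->
  size (word_mul (word_inv u) v) + (lcp u v).*2 = size u + size v.
Proof.
have step a (u' v' : seq (X * bool)) :
    word_mul (word_inv (a :: u')) v' = word_mul (word_inv u') (push (letter_inv a) v').
  by rewrite /word_inv /= rev_cons /word_mul foldr_rcons.
have no_cancel (u' v' : seq (X * bool)) : reduced u' -> lcp u' v' = 0 ->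
    size (word_mul (word_inv u') v') = size u' + size v'.
  elim: u' v' => [|a u' IH] v' // ru; rewrite step.
  move=> l0; have -> : push (letter_inv a) v' = letter_inv a :: v'.
    case: v' l0 => [|b v'] //=; rewrite letter_invK eq_sym.
    by case: eqP.
  rewrite IH /= ?addnS //; first exact: path_sorted ru.
  by case: u' ru {IH l0} => //= b u' /andP[/negPf ->].
elim: u v => [|a u IH] v; first by rewrite addn0.
move=> ru rv; case: v rv => [|b v] rv; first by rewrite no_cancel /= ?addn0.
have [ab|/lcp_neq ab] := eqVneq a b; last by rewrite ab addn0 no_cancel.
rewrite step /= ab letter_invK eqxx doubleS !addnS.
rewrite IH ?addSn //; [exact: path_sorted ru|exact: path_sorted rv].
Qed.

Lemma len_mulV g h : len (g^-1 * h) + (cancel_len g h).*2 = len g + len h.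
Proof. exact: word_mulV_size (wordP g) (wordP h). Qed.

Lemma len_mul g h : len (g * h) + (cancel_len g^-1 h).*2 = len g + len h.
Proof. by rewrite -{1}[g]invgK len_mulV lenV. Qed.

Lemma len_mul_le g h : len (g * h) <= len g + len h.
Proof. by rewrite -len_mul leq_addr. Qed.

Lemma take_reduced k (u : seq (X * bool)) : reduced u -> reduced (take k u).
Proof. by move=> ru; rewrite /reduced; apply: take_sorted. Qed.

Definition prefix_of k g : free_group X := FreeGroup (take_reduced k (wordP g)).

Lemma len_prefix_of k g : k <= len g -> len (prefix_of k g) = k.
Proof. by move=> kg; rewrite /len size_takel. Qed.

Lemma cancel_prefix_of k g : k <= len g -> cancel_len (prefix_of k g) g = k.
Proof. by move=> kg; rewrite /cancel_len lcp_take_self; apply/minn_idPl. Qed.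

Lemma prefix_of_common k g h : k <= cancel_len g h -> prefix_of k g = prefix_of k h.
Proof. by move=> kgh; apply/val_inj; exact: lcp_take. Qed.

Lemma len_prefix_mul k g : k <= len g -> len ((prefix_of k g)^-1 * g) = len g - k.
Proof.
move=> kg; have := len_mulV (prefix_of k g) g.
rewrite len_prefix_of // cancel_prefix_of // -addnn addnA addnC => /addnI <-.
by rewrite addnC addKn.
Qed.

(** Write [p] for the removed prefix. Then [g^-1 * p] still shares [len g - j] letters with [g^-1],
    hence all [k] letters of [q], which cancel completely. *)
Lemma len_trim j k g : j + k <= len g ->
  len ((prefix_of j g)^-1 * g * prefix_of k g^-1) = len g - j - k.
Proof.
move=> jk; set p := prefix_of j g; set q := prefix_of k g^-1.
have jg : j <= len g by lia.
have kg : k <= len g^-1 by rewrite lenV; lia.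
have := len_mul (p^-1 * g) q; rewrite invgM invgK.
have := len_mulV (g^-1 * p) g^-1; rewrite invgM invgK mulgK.
have := cancel_len_ultra (g^-1 * p) g^-1 q.
have := cancel_len_le q (g^-1 * p); rewrite (cancel_lenC q).
have <- := lenV (p^-1 * g); rewrite invgM invgK.
have : len (g^-1 * p) = len g - j.
  by rewrite -lenV invgM invgK len_prefix_mul.
rewrite (cancel_lenC g^-1 q) cancel_prefix_of // !lenV !len_prefix_of //.
move: (len (g^-1 * p)) (cancel_len (g^-1 * p) q) (cancel_len (g^-1 * p) g^-1).
by move: (len (p^-1 * g * q)) (len g) jk; clear; lia.
Qed.

(* A reduced word cannot be its own inverse up to its middle. *)
Lemma cancel_len_inv g : g != 1 -> (cancel_len g^-1 g).*2 < len g.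
Proof.
move=> g1; rewrite ltnNge; apply/negP => le_c.
have [[i b] _] : exists a : X * bool, a \in word g.
  move: g1; rewrite -len_eq0 /len; case: (word g) => [|a w] // _.
  by exists a; rewrite mem_head.
set z := (i, b); set w := word g; set n := len g.
have n_gt0 : 0 < n by rewrite lt0n len_eq0.
have nthV k : k < cancel_len g^-1 g -> nth z w k = letter_inv (nth z w (n - k.+1)).
  move=> kc.
  have kn : k < n by apply: leq_trans kc _; rewrite cancel_lenC cancel_len_le.
  have := congr1 (fun u => nth z u k) (lcp_take (leqnn (cancel_len g^-1 g))).
  rewrite !nth_take // => <- /=.
  rewrite /word_inv nth_rev size_map // (nth_map z) // -/n.
  by rewrite ltn_subrL.
have letter_neq (a : X * bool) : a <> letter_inv a by case: a => j [].
have redN k : k.+1 < n -> nth z w k.+1 <> letter_inv (nth z w k).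
  move=> kn; have := wordP g; rewrite /reduced => /(sortedP z)/(_ k kn).
  by move/eqP.
have := odd_double_half n; case: (odd n); rewrite ?add1n ?add0n => nE.
- have mc : n./2 < cancel_len g^-1 g.
    by rewrite -ltn_double nE.
  have := nthV _ mc; have -> : n - n./2.+1 = n./2.
    by rewrite -{1}nE -addnn subSS addnK.
  exact: letter_neq.
- have m_gt0 : 0 < n./2 by rewrite -double_gt0 nE.
  have mc : n./2.-1 < cancel_len g^-1 g by rewrite prednK // -leq_double nE.
  have := nthV _ mc; rewrite prednK //.
  have -> : n - n./2 = n./2 by rewrite -{1}nE -addnn addnK.
  move=> E; apply: (redN n./2.-1).
    by rewrite prednK // -{2}nE -addnn -{1}[n./2]addn0 ltn_add2l.
  by rewrite prednK // E letter_invK.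
Qed.

End Length.

(** * Products over Nielsen reduced families *)

Section NielsenReduced.
Variables (X : choiceType) (F : X * bool -> free_group X).
Hypothesis F1 : forall l, F l != 1.
Hypothesis N1l : forall l m, m != letter_inv l ->
  (cancel_len (F l)^-1 (F m)).*2 <= len (F l).
Hypothesis N1r : forall l m, m != letter_inv l ->
  (cancel_len (F l)^-1 (F m)).*2 <= len (F m).
Hypothesis N2 : forall l m k, m != letter_inv l -> k != letter_inv m ->
  cancel_len (F l)^-1 (F m) + cancel_len (F m)^-1 (F k) < len (F m).

Let prodF (w : seq (X * bool)) := foldr (fun l g => F l * g) 1 w.

(** By induction, the product starts with a longer piece of its first factor than any admissible
    left neighbour can cancel. So the cancellation at each junction is the one between the two
    adjacent factors, and being at most half of each it never shortens the product. *)
Lemma nielsen_reduced_len w l : reduced w -> l \in w -> len (F l) <= len (prodF w).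
Proof.
suff main m u : reduced (m :: u) ->
    [/\ forall k, m != letter_inv k ->
          cancel_len (F k)^-1 (F m) < cancel_len (prodF (m :: u)) (F m),
        len (F m) <= len (prodF (m :: u)) &
        forall k, k \in m :: u -> len (F k) <= len (prodF (m :: u))].
  case: w => [|m u] // ru; have [_ _] := main m u ru; exact.
elim: u m => [|n u IH] m ru.
  rewrite /prodF /= mulg1; split=> // [k mk|k]; last by rewrite inE => /eqP->.
  rewrite cancel_len_self; have := N1r mk.
  have : 0 < len (F m) by rewrite lt0n len_eq0.
  lia.
have /= /andP[nm ru'] := ru.
have [c_lt n_le le_all] := IH n ru'.
rewrite -[F n * prodF u]/(prodF (n :: u)).
set g := prodF (n :: u) in c_lt n_le le_all *.
have cE : cancel_len (F m)^-1 g = cancel_len (F m)^-1 (F n).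
  have := c_lt m nm.
  have := cancel_len_ultra (F m)^-1 g (F n).
  have := cancel_len_ultra (F m)^-1 (F n) g.
  rewrite (cancel_lenC (F n) g); lia.
have gE := len_mul (F m) g; rewrite cE in gE.
have := N1l nm; have := N1r nm => N1r' N1l'.
have m_le : len (F m) <= len (F m * g) by lia.
have g_le : len g <= len (F m * g) by lia.
split=> // [k mk|k].
- have := N2 mk nm; have := len_mulV (F m) (F m * g); rewrite mulKg.
  rewrite (cancel_lenC (F m * g)); lia.
- rewrite inE => /orP[/eqP-> //|/le_all kg]; exact: leq_trans g_le.
Qed.

End NielsenReduced.

Section Nielsen.
Variable Z : out F2 -> Prop.
Local Notation R f := (Z (cl f)).
Hypothesis Z1 : Z 1.
Hypothesis Z_swap : forall o, Z o -> Z (o * cl F2_swap).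
Hypothesis Z_sign : forall o, Z o -> Z (o * cl F2_sign).
Hypothesis Z_shearV : forall o, Z o -> Z (o * (cl F2_shear)^-1).

Let tot (f : aut F2) := len (f F2x) + len (f F2y).

(** All eight signed permutations of the basis turn out to be of this kind, so they may be applied
    freely to a counterexample of least length. *)
Let sym (d : aut F2) := forall f, (R f <-> R (f * d)) /\ tot (f * d) = tot f.

Let clM f k : cl (f * k) = cl f * cl k.
Proof. exact: piM. Qed.

Let clV f : cl f^-1 = (cl f)^-1.
Proof. exact: piV. Qed.

Let sym_mul d e : sym d -> sym e -> sym (d * e).
Proof.
move=> sd se f; have [fd td] := sd f; have [fe te] := se (f * d).
by rewrite mulgA te td; split=> //; exact: iff_trans fd fe.
Qed.

Let sym_one : sym 1.
Proof. by move=> f; rewrite mulg1. Qed.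

Let aut_eq (f k : aut F2) : f F2x == k F2x -> f F2y == k F2y -> f = k.
Proof.
by move=> /eqP fx /eqP fy; apply: autP; apply: F2_morph_ext => //; exact: autM.
Qed.

Let sym_swap : sym F2_swap.
Proof.
move=> f; split; last by rewrite /tot !aut_mulE /= !F2_endoE addnC.
split=> [Rf|Rf]; first by rewrite clM; exact: Z_swap.
have -> : f = f * F2_swap * F2_swap.
  rewrite -mulgA (_ : F2_swap * F2_swap = 1) ?mulg1 //.
  by apply: aut_eq; vm_compute.
by rewrite clM; exact: Z_swap.
Qed.

Let sym_sign : sym F2_sign.
Proof.
move=> f; split; last by rewrite /tot !aut_mulE /= !F2_endoE autV lenV.
split=> [Rf|Rf]; first by rewrite clM; exact: Z_sign.
have -> : f = f * F2_sign * F2_sign.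
  rewrite -mulgA (_ : F2_sign * F2_sign = 1) ?mulg1 //.
  by apply: aut_eq; vm_compute.
by rewrite clM; exact: Z_sign.
Qed.

Let letter (l : 'I_2 * bool) : F2 := letter_val (fun i => gen i) l.

Let sym_letters l m : l.1 != m.1 ->
  exists d, [/\ sym d, d F2x = letter l & d F2y = letter m].
Proof.
have sym_signy := sym_mul (sym_mul sym_swap sym_sign) sym_swap.
have ex d : sym d -> (d F2x == letter l) && (d F2y == letter m) ->
    exists d, [/\ sym d, d F2x = letter l & d F2y = letter m].
  by move=> sd /andP[/eqP dx /eqP dy]; exists d.
have s1 := sym_mul sym_swap sym_sign.
have s2 := sym_mul sym_sign sym_swap.
have s3 := sym_mul s2 sym_sign.
have s4 := sym_mul sym_sign sym_signy.
case: l m ex => i [] [j []]; elim/forall_ord2: i; elim/forall_ord2: j => ex // _;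
  first [ by apply: (ex _ sym_one); vm_compute
        | by apply: (ex _ sym_swap); vm_compute
        | by apply: (ex _ sym_sign); vm_compute
        | by apply: (ex _ sym_signy); vm_compute
        | by apply: (ex _ s1); vm_compute
        | by apply: (ex _ s2); vm_compute
        | by apply: (ex _ s3); vm_compute
        | by apply: (ex _ s4); vm_compute ].
Qed.

(** The sign change of [F2y] conjugates the shear to its inverse, so closure under the inverse shear
    gives closure under the shear. *)
Let R_shear f : R f <-> R (f * F2_shear).
Proof.
split=> [Rf|]; last by rewrite clM => /Z_shearV; rewrite mulgK.
set y := F2_swap * F2_sign * F2_swap.
have sy : sym y by exact: sym_mul (sym_mul sym_swap sym_sign) sym_swap.
have -> : F2_shear = y * F2_shear^-1 * y by apply: aut_eq; vm_compute.
rewrite mulgA; apply: (sy (f * _)).1.1; rewrite mulgA clM clV.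
exact/Z_shearV/(sy f).1.1.
Qed.

(* A counterexample to R of least total length. *)
Let critical f := ~ R f /\ forall k, tot k < tot f -> R k.

Let critical_sym f d : sym d -> critical f -> critical (f * d).
Proof.
move=> sd [nRf min_f]; have [fd td] := sd f.
by split=> [/fd //|k]; rewrite td; exact: min_f.
Qed.

Let critical_mul f : critical f -> len (f F2x) <= len (f F2x * f F2y).
Proof.
move=> [nRf min_f]; rewrite leqNgt; apply/negP => lt_f; apply/nRf/R_shear/min_f.
by rewrite /tot !aut_mulE /= !F2_endoE autM ltn_add2r.
Qed.

Let critical_letters f l m : critical f -> l.1 != m.1 ->
  len (f (letter l)) <= len (f (letter l) * f (letter m)).
Proof.
move=> cf /sym_letters[d [sd <- <-]].
exact: critical_mul (critical_sym sd cf).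
Qed.

(* If b = p q^-1 with |p| = |q| and e = p m q^-1, then conjugating the basis
   (b, e b^-1) by p^-1 gives (q^-1 p, m), which is shorter than (b, e). *)
Let critical_half f : critical f ->
  (cancel_len (f F2y) (f F2x)).*2 = len (f F2x) ->
  (cancel_len (f F2y)^-1 (f F2x)^-1).*2 = len (f F2x) ->
  len (f F2x) <= len (f F2y) -> False.
Proof.
move=> [nRf min_f]; set b := f F2x; set e := f F2y => c1 c2 be.
set h := cancel_len e b in c1; set p := prefix_of h b.
have hb : h <= len b by rewrite /h cancel_lenC cancel_len_le.
have he : h <= len e by exact: cancel_len_le.
have pe : p = prefix_of h e by apply: prefix_of_common; rewrite cancel_lenC.
set q := prefix_of h b^-1.
have c2h : cancel_len e^-1 b^-1 = h by apply: double_inj; rewrite c1 c2.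
have qe : q = prefix_of h e^-1.
  by apply: prefix_of_common; rewrite cancel_lenC c2h.
have lp : len p = h by exact: len_prefix_of.
have lq : len q = h by apply: len_prefix_of; rewrite lenV.
have bE : b = p * q^-1.
  have : len (p^-1 * b * q) = 0 by rewrite len_trim; lia.
  move/eqP; rewrite len_eq0 => /eqP/(congr1 (fun g => p * g * q^-1)).
  by rewrite !mulgA mulgV mul1g mulgK mulg1.
have eE : len (p^-1 * e * q) = len e - len b by rewrite pe qe len_trim; lia.
have b_gt0 : 0 < len b.
  rewrite lt0n len_eq0; apply/eqP => b1.
  have : F2x = 1 :> F2 by apply: (can_inj (aut_funK f)); rewrite aut1 -/b.
  by move/(congr1 (@word _)).
pose f' := f * F2_swap * F2_shear^-1 * F2_swap.
have f'x : f' F2x = b.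
  rewrite /f' !aut_mulE.
  by have -> : F2_swap (F2_shear^-1 (F2_swap F2x)) = F2x by apply/eqP; vm_compute.
have f'y : f' F2y = e * b^-1.
  rewrite /f' !aut_mulE.
  have -> : F2_swap (F2_shear^-1 (F2_swap F2y)) = F2y * F2x^-1.
    by apply/eqP; vm_compute.
  by rewrite autM autV.
have nRf' : ~ R f'.
  move=> Rf'; apply: nRf; apply: (sym_swap f).1.2.
  rewrite -(mulgVK F2_shear (f * F2_swap)); apply: (R_shear _).1.
  exact: (sym_swap _).1.2.
clearbody f'; apply: nRf'; rewrite -(out_inner _ p^-1); apply: min_f.
rewrite /tot !aut_mulE f'x f'y /= invgK -/b -/e.
have -> : p^-1 * b * p = q^-1 * p by rewrite bE mulKg.
have -> : p^-1 * (e * b^-1) * p = p^-1 * e * q.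
  by rewrite bE invgM invgK !mulgA mulgVK.
have := len_mul_le q^-1 p; rewrite lenV eE lp lq addnn c1.
by move: (len _) (len b) (len e) be b_gt0; clear; lia.
Qed.

Let letter_inv_letter l : letter (letter_inv l) = (letter l)^-1.
Proof. exact: letter_val_inv. Qed.

Let aut_inj (f : aut F2) : injective f.
Proof. exact: can_inj (aut_funK f). Qed.

Let letter_neq1 (f : aut F2) l : f (letter l) != 1.
Proof.
apply/eqP => f1; have : letter l = 1 by apply: (aut_inj (f := f)); rewrite f1 aut1.
by case: l {f1} => i []; move/(congr1 (@word _)).
Qed.

Let critical_half_letters f l m : critical f -> l.1 != m.1 ->
  (cancel_len (f (letter m)) (f (letter l))).*2 = len (f (letter l)) ->
  (cancel_len (f (letter m))^-1 (f (letter l))^-1).*2 = len (f (letter l)) ->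
  len (f (letter l)) <= len (f (letter m)) -> False.
Proof.
move=> cf /sym_letters[d [sd <- <-]].
exact: critical_half (critical_sym sd cf).
Qed.

Section Critical.
Variable f : aut F2.
Hypothesis f_critical : critical f.

Let F l := f (letter l).

Let FV l : F (letter_inv l) = (F l)^-1.
Proof. by rewrite /F letter_inv_letter autV. Qed.

Let letter_cases (l m : 'I_2 * bool) : m != letter_inv l -> l.1 = m.1 -> l = m.
Proof. by case: l m => i [] [j []] //= + E; rewrite /letter_inv /= E ?eqxx. Qed.

Let N1_self l : (cancel_len (F l)^-1 (F l)).*2 < len (F l).
Proof. exact/cancel_len_inv/letter_neq1. Qed.

(** For letters of different generators, criticality is applied to [l], [m] and to their inverses in
    reverse order; each use bounds the cancellation by half of one factor. A repeated letter falls
    under [N1_self]. *)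
Let N1 l m : m != letter_inv l ->
  (cancel_len (F l)^-1 (F m)).*2 <= len (F l) /\ (cancel_len (F l)^-1 (F m)).*2 <= len (F m).
Proof.
move=> ml; have [/(letter_cases ml) <-|lm] := eqVneq l.1 m.1.
  by split; exact/ltnW/N1_self.
have ml' : (letter_inv m).1 != (letter_inv l).1 by rewrite eq_sym.
have h1 : len (F l) <= len (F l * F m) := critical_letters f_critical lm.
have : len (F (letter_inv m)) <= len (F (letter_inv m) * F (letter_inv l)).
  exact: critical_letters f_critical ml'.
rewrite !FV -invgM !lenV => h2; have := len_mul (F l) (F m).
move: h1 h2; move: (len _) (len (F l)) (len (F m)) (cancel_len _ _).
by clear; split; lia.
Qed.

(** If both neighbours involve the other generator, a failure means that exactly half of [F m]
    cancels on either side, and [k] is [l] or its inverse. The former is excluded by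
    [critical_half]; in the latter case [F m] would cancel against itself up to its middle. *)
Let N2 l m k : m != letter_inv l -> k != letter_inv m ->
  cancel_len (F l)^-1 (F m) + cancel_len (F m)^-1 (F k) < len (F m).
Proof.
move=> ml km; have [c1 c1'] := N1 ml; have [c2 c2'] := N1 km.
have [/(letter_cases ml) lm|lm] := eqVneq l.1 m.1.
  by have := N1_self l; rewrite lm in c1 c1' *; lia.
have [/(letter_cases km) mk|mk] := eqVneq m.1 k.1.
  by have := N1_self k; rewrite -mk in c2 c2' *; lia.
rewrite ltnNge; apply/negP => c_le.
have e1 : (cancel_len (F l)^-1 (F m)).*2 = len (F m) by lia.
have e2 : (cancel_len (F m)^-1 (F k)).*2 = len (F m) by lia.
have [kl|kl] : k = l \/ k = letter_inv l.
  by move: lm mk; case: l {ml c1 c1' e1 c_le} => i []; case: m {km c2 c2' e2} => j [];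
    case: k => h []; elim/forall_ord2: i; elim/forall_ord2: j; elim/forall_ord2: h => //=; auto.
- have mVl : m.1 != (letter_inv l).1 by rewrite eq_sym.
  apply: (critical_half_letters f_critical mVl); rewrite -/(F _) -/(F (letter_inv l)) FV //.
  + by rewrite invgK cancel_lenC -e2 kl.
  + by rewrite lenV -e1.
- have := cancel_len_ultra (F m)^-1 (F l)^-1 (F m).
  have := N1_self m; rewrite kl FV in e2; lia.
Qed.

(** The images of the letters form a Nielsen reduced family, and each generator, of length 1, is a
    product of them. So the factors that occur have length 1, and [f] is a signed permutation of the
    basis, for which [R] holds. *)
Lemma critical_false : False.
Proof.
have prodE g : f g = foldr (fun l k => F l * k) 1 (word g).
  rewrite -{1}(free_hom_id g) (free_hom_comp _ _ (autM f)) free_homE.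
  elim: (word g) => //= -[i b] w ->; congr (_ * _).
  by case: b; rewrite /F /letter /letter_val //= autV.
have len_le g l : len (f g) <= 1 -> l \in word g -> len (F l) <= 1.
  move=> fg lg; apply: leq_trans fg; rewrite prodE.
  exact: (nielsen_reduced_len (letter_neq1 f) (fun l m ml => (N1 ml).1)
    (fun l m ml => (N1 ml).2) N2 (wordP g) lg).
have FE l : len (F l) = len (f (gen l.1)).
  by case: l => i []; rewrite /F /letter /letter_val //= autV lenV.
have gx l : l \in word (aut_inv f F2x) -> len (f (gen l.1)) <= 1.
  by rewrite -FE; apply: len_le; rewrite aut_invK.
have gy l : l \in word (aut_inv f F2y) -> len (f (gen l.1)) <= 1.
  by rewrite -FE; apply: len_le; rewrite aut_invK.
have comm_gen (j : 'I_2) (g h : F2) : (forall l, l \in word g -> l.1 = j) ->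
    commute h (gen j) -> commute h g.
  move=> gj hj; rewrite -(free_hom_id g) free_homE.
  elim: (word g) gj => [|[k b] w IH] wj; first exact: commute1.
  have /= kj := wj (k, b) (mem_head _ _).
  apply: commuteM; last by apply: IH => l lw; apply: wj; rewrite inE lw orbT.
  by rewrite /letter_val /= kj; case: b {wj}; [|exact: commuteV].
(* If the image of [gen i] were longer, the preimages of [F2x] and [F2y] would be words in the other
   generator alone, so [F2x] and [F2y] would commute. *)
have gen_le i : len (f (gen i)) <= 1.
  rewrite leqNgt; apply/negP => gt1.
  pose j : 'I_2 := if i == ord0 then ord_max else ord0.
  have only_j g : (forall l, l \in word g -> len (f (gen l.1)) <= 1) ->
      forall l : 'I_2 * bool, l \in word g -> l.1 = j.
    move=> gP l lg; have := gP l lg; rewrite /j {j}.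
    by case: l {lg} => k b /=; elim/forall_ord2: i gt1; elim/forall_ord2: k => //;
      rewrite ltnNge => /negPf->.
  have yj := comm_gen j _ _ (only_j _ gy) (commute_refl _).
  have := comm_gen j _ _ (only_j _ gx) (commute_sym yj).
  move/(commute_inj_morph (autM f)); rewrite !aut_invK => /eqP.
  by vm_compute.
have letterP g : len (f g) <= 1 -> g != 1 -> exists l, f g = letter l.
  move=> le1 g1; have : f g != 1.
    by apply: contra g1 => /eqP fg; apply/eqP/(aut_inj (f := f)); rewrite fg aut1.
  rewrite -len_eq0; move: le1; rewrite /len.
  case E: (word (f g)) => [|l [|m w]] //= _ _; exists l.
  by rewrite -(free_hom_id (f g)) free_homE E /= mulg1.
have [l fx] := letterP F2x (gen_le ord0) isT.
have [m fy] := letterP F2y (gen_le ord_max) isT.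
have lm : l.1 != m.1.
  apply/eqP => lm; have [ml|ml] := eqVneq m (letter_inv l).
    have : f F2y = f F2x^-1 by rewrite autV fx fy ml letter_inv_letter.
    by move/(aut_inj (f := f))/eqP; vm_compute.
  have : f F2y = f F2x by rewrite fx fy (letter_cases ml lm).
  by move/(aut_inj (f := f))/eqP; vm_compute.
have [d [sd dx dy]] := sym_letters lm.
case: f_critical => nRf _; apply: nRf.
have -> : f = 1 * d by rewrite mul1g; apply: aut_eq; rewrite ?fx ?fy ?dx ?dy.
exact: (sd 1).1.1.
Qed.
End Critical.

Lemma out_F2_gen_aux f : R f.
Proof.
have [n] := ubnP (tot f); elim: n f => // n IH f; rewrite ltnS => fn.
have [//|nRf] := pselect (R f).
case: (@critical_false f); split=> // k kf; apply: IH.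
exact: leq_trans fn.
Qed.

Lemma out_F2_gen o : Z o.
Proof. by rewrite -[o]reprK; exact: out_F2_gen_aux. Qed.

End Nielsen.

(** * The congruence property of Out F2 *)

Section OutF2Form.

Local Notation p := (cl F2_swap).
Local Notation s := (cl F2_sign).
Local Notation v := (cl F2_shear).
Local Notation v' := (p * v * p).
Local Notation tw w := (cl (twist w)).

Let twM w1 w2 : tw (w1 * w2) = tw w1 * tw w2.
Proof. by rewrite twistM clM. Qed.

Let twx : tw F2x = cl twist_x.
Proof. by rewrite twist_gen. Qed.

Let twy : tw F2y = cl twist_y.
Proof. by rewrite twist_gen. Qed.

Let swap_swap : p * p = 1.
Proof. by rewrite -clM; apply: (F2_out_eq (g := 1)); apply/eqP; vm_compute. Qed.

Let swapK (o : out F2) : p * (p * o) = o.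
Proof. by rewrite mulgA swap_swap mul1g. Qed.

Let sign_sign : s * s = 1.
Proof. by rewrite -clM; apply: (F2_out_eq (g := 1)); apply/eqP; vm_compute. Qed.

Let sign_swap_sign : s * (p * s * p) = p * s * p * s.
Proof. by rewrite -!clM; apply: (F2_out_eq (g := 1)); apply/eqP; vm_compute. Qed.

Let shear_shear : v * v = tw F2y.
Proof. by rewrite twy -!clM; apply: (F2_out_eq (g := 1)); apply/eqP; vm_compute. Qed.

Let swap_twist_x : p * tw F2x = tw F2y * p.
Proof. by rewrite twx twy -!clM; apply: (F2_out_eq (g := 1)); apply/eqP; vm_compute. Qed.

Let sign_twist_x : tw F2x * s * tw F2x = s.
Proof. by rewrite twx -!clM; apply: (F2_out_eq (g := 1)); apply/eqP; vm_compute. Qed.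

Let sign_twist_y : tw F2y * s * tw F2y = s.
Proof.
by rewrite twy -!clM; apply: (F2_out_eq (g := F2y^-1 * F2y^-1)); apply/eqP; vm_compute.
Qed.

Let twyV : tw F2y^-1 = cl twist_y^-1.
Proof. by rewrite /twist free_homV free_hom_gen. Qed.

Let shear_sign : v * s = s * tw F2y^-1 * v.
Proof.
by rewrite twyV -!clM; apply: (F2_out_eq (g := F2y^-1)); apply/eqP; vm_compute.
Qed.

Let shear_signy : v * (p * s * p) = p * s * p * tw F2y^-1 * v.
Proof.
by rewrite twyV -!clM; apply: (F2_out_eq (g := 1)); apply/eqP; vm_compute.
Qed.

(** This turns v' v^-1 into a twist and a signed permutation times v', the one product in
    [out_F2_form] where the two shears meet. *)
Let shears : v' = tw F2y * p * s * v' * v.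
Proof.
by rewrite twy -!clM; apply: (F2_out_eq (g := F2y)); apply/eqP; vm_compute.
Qed.

Definition sign_perm (i j k : bool) : aut F2 :=
  F2_swap ^+ i * F2_sign ^+ j * (F2_swap * F2_sign * F2_swap) ^+ k.

Let dih i j k := cl (sign_perm i j k).

Let dihE i j k : dih i j k = p ^+ i * s ^+ j * (p * s * p) ^+ k.
Proof.
have clX (f : aut F2) (b : bool) : cl (f ^+ b) = cl f ^+ b by case: b.
by rewrite /dih /sign_perm !clM !clX !clM.
Qed.

Let dih_swap i j k : dih i j k * p = dih (~~ i) k j.
Proof.
have sj (b : bool) : s ^+ b * p = p * (p * s * p) ^+ b.
  by case: b; rewrite ?expgb /= ?mul1g ?mulg1 // !mulgA swap_swap mul1g.
have syk (b : bool) : (p * s * p) ^+ b * p = p * s ^+ b.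
  by case: b; rewrite ?expgb /= ?mul1g ?mulg1 // -!mulgA swap_swap mulg1.
have comm : (p * s * p) ^+ j * s ^+ k = s ^+ k * (p * s * p) ^+ j.
  by case: j; case: k; rewrite ?expgb /= ?mul1g ?mulg1 // sign_swap_sign.
have pi : p ^+ i * p = p ^+ (~~ i) by case: i; rewrite ?expgb /= ?mul1g ?swap_swap.
rewrite !dihE -(mulgA (p ^+ i * _) _ p) syk mulgA -(mulgA (p ^+ i) _ p) sj.
by rewrite mulgA pi -mulgA comm mulgA.
Qed.

Let dih_sign i j k : dih i j k * s = dih i (~~ j) k.
Proof.
have comm : (p * s * p) ^+ k * s = s * (p * s * p) ^+ k.
  by case: k; rewrite ?expgb /= ?mul1g ?mulg1 // sign_swap_sign.
have sj : s ^+ j * s = s ^+ (~~ j) by case: j; rewrite ?expgb /= ?mul1g ?sign_sign.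
by rewrite !dihE -(mulgA (p ^+ i * _) _ s) comm mulgA -(mulgA (p ^+ i) _ s) sj.
Qed.

Let swap_tw w : exists w', p * tw w = tw w' * p.
Proof.
exists (F2_endo F2y F2x w).
have := @F2_morph_ext _ (fun w => p * tw w * p^-1) (fun w => tw (F2_endo F2y F2x w)).
rewrite F2_endo_x F2_endo_y swap_twist_x mulgK => H.
rewrite -H ?mulgVK // => [u u'|u u'|].
- by rewrite twM !mulgA mulgVK.
- by rewrite F2_endoM twM.
- apply: (canLR (mulgK _)); apply: (mulgI p).
  by rewrite !mulgA swap_swap mul1g swap_twist_x -mulgA swap_swap mulg1.
Qed.

Let sign_tw w : exists w', s * tw w = tw w' * s.
Proof.
have twV u : tw u^-1 = (tw u)^-1 by rewrite /twist free_homV; exact: piV.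
have sV : s^-1 = s by apply: mulg1_eq; exact: sign_sign.
exists (F2_endo F2x^-1 F2y^-1 w).
have := @F2_morph_ext _ (fun w => s * tw w * s^-1)
  (fun w => tw (F2_endo F2x^-1 F2y^-1 w)).
rewrite F2_endo_x F2_endo_y => H.
rewrite -H ?mulgVK // => [u u'|u u'||].
- by rewrite twM !mulgA mulgVK.
- by rewrite F2_endoM twM.
- by apply: (mulgI (tw F2x)); rewrite twV mulgV !mulgA sign_twist_x mulgV.
- by apply: (mulgI (tw F2y)); rewrite twV mulgV !mulgA sign_twist_y mulgV.
Qed.

Let dih_tw i j k w : exists w', dih i j k * tw w = tw w' * dih i j k.
Proof.
have Xtw (o : out F2) (b : bool) : (forall w, exists w', o * tw w = tw w' * o) ->
    forall w, exists w', o ^+ b * tw w = tw w' * o ^+ b.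
  by move=> oP u; case: b; rewrite expgb //; exists u; rewrite /= mul1g mulg1.
have Mtw (o o' : out F2) : (forall w, exists w', o * tw w = tw w' * o) ->
    (forall w, exists w', o' * tw w = tw w' * o') ->
    forall w, exists w', o * o' * tw w = tw w' * (o * o').
  move=> oP o'P u; have [u1 E1] := o'P u; have [u2 E2] := oP u1.
  by exists u2; rewrite -mulgA E1 mulgA E2 mulgA.
have sy := Mtw _ _ (Mtw _ _ swap_tw sign_tw) swap_tw.
rewrite !dihE.
exact: (Mtw _ _ (Mtw _ _ (Xtw _ i swap_tw) (Xtw _ j sign_tw)) (Xtw _ k sy)).
Qed.

(** The values are 1, the shear and its conjugate by the swap; they represent the translates of
    [E]. *)
Definition shear_rep (b c : bool) : aut F2 :=
  F2_swap ^+ c * F2_shear ^+ b * F2_swap ^+ c.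

Let shear_repE b c : cl (shear_rep b c) = p ^+ c * v ^+ b * p ^+ c.
Proof.
have clX (f : aut F2) (i : bool) : cl (f ^+ i) = cl f ^+ i by case: i.
by rewrite !clM !clX.
Qed.

Let E (o : out F2) := exists w i j k, o = tw w * dih i j k.

Let E_tw o w : E o -> E (o * tw w).
Proof.
move=> [u [i [j [k ->]]]]; have [w' ww'] := dih_tw i j k w.
by exists (u * w'), i, j, k; rewrite twM -mulgA ww' mulgA.
Qed.

Let E_swap o : E o -> E (o * p).
Proof.
by move=> [u [i [j [k ->]]]]; exists u, (~~ i), k, j; rewrite -mulgA dih_swap.
Qed.

Let E_sign o : E o -> E (o * s).
Proof.
by move=> [u [i [j [k ->]]]]; exists u, i, (~~ j), k; rewrite -mulgA dih_sign.
Qed.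

(** [E] is stable under right multiplication by twists, the swap and the sign change, and each
    generator carries a translate of [E] into another one: the shear squares to a twist, and
    [shears] settles the mixed product. *)
Lemma out_F2_form (o : out F2) : exists w i j k b c,
  o = cl (twist w) * (cl (sign_perm i j k) * cl (shear_rep b c)).
Proof.
suff : exists b c, exists2 e, E e & o = e * cl (shear_rep b c).
  move=> [b [c [e [w [i [j [k ->]]]] ->]]].
  by exists w, i, j, k, b, c; rewrite mulgA.
elim/out_F2_gen: o => [|o [b [c [e Ee ->]]]|o [b [c [e Ee ->]]]|o [b [c [e Ee ->]]]];
  rewrite ?shear_repE.
- exists false, false, 1; last by rewrite shear_repE !expgb /= !mulg1.
  exists 1, false, false, false; rewrite dihE !expgb !mulg1.
  by rewrite /twist free_hom1.
- exists b, (~~ c), (e * p); first exact: E_swap.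
  rewrite shear_repE !expgb; case: c => /=; rewrite ?mulg1 ?mul1g -!mulgA ?swap_swap ?mulg1 //.
  by rewrite (mulgA p p) swap_swap mul1g.
- case: b; case: c; rewrite !expgb /= ?mul1g ?mulg1.
  + exists true, true, (e * p * p * s * p * tw F2y^-1 * p).
      exact/E_swap/E_tw/E_swap/E_sign/E_swap/E_swap.
    rewrite shear_repE !expgb /=.
    have -> : e * (p * v * p) * s = e * p * (v * (p * s * p)) * p.
      by rewrite -!mulgA swap_swap mulg1.
    by rewrite shear_signy -!mulgA !swapK.
  + exists true, false, (e * s * tw F2y^-1); first exact/E_tw/E_sign.
    by rewrite shear_repE !expgb /= mul1g mulg1 -mulgA shear_sign !mulgA.
  + exists false, false, (e * s); first exact: E_sign.
    by rewrite shear_repE !expgb /= !mulg1 swap_swap mulg1.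
  + by exists false, false, (e * s); [exact: E_sign|rewrite shear_repE !expgb /= !mulg1].
- have vV : v^-1 = tw F2y^-1 * v.
    apply: (mulIg v); rewrite mulVg -mulgA shear_shear -twM mulVg.
    by rewrite /twist free_hom1.
  case: b; case: c; rewrite !expgb /= ?mul1g ?mulg1.
  + exists true, true, (e * tw F2y * p * s); first exact/E_sign/E_swap/E_tw.
    by rewrite shear_repE !expgb /= {1}shears !mulgA mulgK.
  + exists false, false, e => //.
    by rewrite shear_repE !expgb /= !mulg1 mulgK.
  + exists true, false, (e * tw F2y^-1); first exact: E_tw.
    by rewrite shear_repE !expgb /= mul1g !mulg1 swap_swap mulg1 vV mulgA.
  + exists true, false, (e * tw F2y^-1); first exact: E_tw.
    by rewrite shear_repE !expgb /= mul1g !mulg1 vV mulgA.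
Qed.

End OutF2Form.

(** * Reduction to the twists through exponents modulo 4 *)

Definition inner_mod n (f : aut F2) :=
  exists k, forall g, carrier (perm_kernel 'I_2 n) ((f g)^-1 * (k * g * k^-1)).

(** The exponent sum of one generator modulo 4. The group ['I_4] is Z/4 written multiplicatively:
    products are sums and [^+ 2] is doubling. *)
Definition exponent4 (j : 'I_2) : F2 -> 'I_4 :=
  free_hom (fun i => if i == j then Zp1 else 1).

Lemma I4_mulC (u v : 'I_4) : u * v = v * u.
Proof. exact: Zp_mulgC. Qed.

Lemma I4_mulACA (u v z t : 'I_4) : u * v * (z * t) = u * z * (v * t).
Proof. by rewrite !mulgA -(mulgA u) (I4_mulC v) !mulgA. Qed.

Lemma exponent4M j : {morph exponent4 j : u v / u * v}.
Proof. exact: free_homM. Qed.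

Lemma exponent4J j k g : exponent4 j (k * g * k^-1) = exponent4 j g.
Proof. by rewrite (morph_conj (exponent4M j)) I4_mulC mulKg. Qed.

Lemma free_hom_I4_perm_kernel n (h : 'I_2 -> 'I_4) g k : 4 <= n ->
  carrier (perm_kernel 'I_2 n) (g^-1 * k) -> free_hom h g = free_hom h k.
Proof.
move=> n4 gk.
pose r (u : 'I_4) : {perm 'I_4} := perm (@mulIg _ u).
have rM : {morph r : u v / u * v}.
  by move=> u v; apply/perm.permP => z; rewrite permM !permE mulgA.
have cardI4 : #|'I_4| <= n by rewrite card_ord.
have := perm_kernel_act_eq cardI4 (r \o h) gk.
rewrite -!(free_hom_comp _ _ rM) => /perm.permP/(_ 1).
by rewrite !permE !mul1g.
Qed.

Lemma exponent4_kernel n j g k : 4 <= n ->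
  carrier (perm_kernel 'I_2 n) (g^-1 * k) -> exponent4 j g = exponent4 j k.
Proof. by move=> n4; exact: free_hom_I4_perm_kernel. Qed.

(* The matrix of f on the abelianization modulo 4 has diagonal entries 1 and even
   off-diagonal entries. *)
Definition level4 (f : aut F2) :=
  [&& exponent4 ord0 (f F2x) == Zp1, exponent4 ord_max (f F2y) == Zp1,
      exponent4 ord_max (f F2x) ^+ 2 == 1 & exponent4 ord0 (f F2y) ^+ 2 == 1].

Lemma level4_twist w f : level4 f -> level4 (twist w * f).
Proof.
have I4X4 (u : 'I_4) : u ^+ 2 * u ^+ 2 = 1.
  by apply/eqP; case: u => [[|[|[|[|//]]]] ltu]; vm_compute.
have sqM (u v : 'I_4) : (u * v) ^+ 2 = u ^+ 2 * v ^+ 2.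
  by rewrite !expg2 I4_mulACA.
have sqV (u : 'I_4) : (u ^+ 2)^-1 = u ^+ 2 by apply: mulg1_eq; exact: I4X4.
have ex g : exponent4 ord0 (twist_x g) = exponent4 ord0 g * exponent4 ord_max g ^+ 2.
  apply: (F2_morph_ext (f := fun g => exponent4 ord0 (twist_x g))
    (k := fun g => exponent4 ord0 g * exponent4 ord_max g ^+ 2)) => [u v|u v||].
  - by rewrite autM exponent4M.
  - by rewrite !exponent4M sqM I4_mulACA.
  - by apply/eqP; vm_compute.
  - by apply/eqP; vm_compute.
have ey g : exponent4 ord_max (twist_x g) = exponent4 ord_max g.
  apply: (F2_morph_ext (f := fun g => exponent4 ord_max (twist_x g))) => [u v|u v||].
  - by rewrite autM exponent4M.
  - exact: exponent4M.
  - by apply/eqP; vm_compute.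
  - by apply/eqP; vm_compute.
have fx g : exponent4 ord0 (twist_y g) = exponent4 ord0 g.
  apply: (F2_morph_ext (f := fun g => exponent4 ord0 (twist_y g))) => [u v|u v||].
  - by rewrite autM exponent4M.
  - exact: exponent4M.
  - by apply/eqP; vm_compute.
  - by apply/eqP; vm_compute.
have fy g : exponent4 ord_max (twist_y g) = exponent4 ord_max g * exponent4 ord0 g ^+ 2.
  apply: (F2_morph_ext (f := fun g => exponent4 ord_max (twist_y g))
    (k := fun g => exponent4 ord_max g * exponent4 ord0 g ^+ 2)) => [u v|u v||].
  - by rewrite autM exponent4M.
  - by rewrite !exponent4M sqM I4_mulACA.
  - by apply/eqP; vm_compute.
  - by apply/eqP; vm_compute.
have level4_gen i k : level4 k -> level4 (twist (gen i) * k).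
  rewrite twist_gen; elim/forall_ord2: i; case/and4P=> /eqP kx /eqP ky /eqP kx2 /eqP ky2;
  apply/and4P; split; apply/eqP;
  by rewrite aut_mulE ?ex ?ey ?fx ?fy ?sqM ?I4X4 ?kx2 ?ky2 ?mulg1 //.
have level4_genV i k : level4 k -> level4 ((twist (gen i))^-1 * k).
  (* A twist applied twice changes exponents by multiples of 4, so modulo 4 it acts like its
     inverse. *)
  have inv2 (j : 'I_2) g : exponent4 j (twist (gen i) (twist (gen i) g)) = exponent4 j g.
    rewrite twist_gen; elim/forall_ord2: i j; elim/forall_ord2.
    - by rewrite ex ey ex -mulgA I4X4 mulg1.
    - by rewrite ey ey.
    - by rewrite fx fx.
    - by rewrite fy fx fy -mulgA I4X4 mulg1.
  have invE (j : 'I_2) g : exponent4 j ((twist (gen i))^-1 g) = exponent4 j (twist (gen i) g).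
    by rewrite -inv2 aut_invE aut_invK.
  by move=> /(level4_gen i); rewrite /level4 !aut_mulE !invE.
move=> f4; elim/free_group_ind: w => [|i w IH|i w IH].
- by rewrite /twist free_hom1 mul1g.
- by rewrite twistM -mulgA; exact: level4_gen.
- by rewrite twistM -mulgA [twist _^-1]free_homV; exact: level4_genV.
Qed.

(** Modulo 4, unlike modulo 2, signs are visible; a shear shows by an odd off-diagonal entry. *)
Lemma level4_sign_shear i j k b c :
  level4 (sign_perm i j k * shear_rep b c) ==> ~~ [|| i, j, k | b].
Proof. by case: i; case: j; case: k; case: b; case: c; vm_compute. Qed.

(** Exponents modulo 4 are invariant under conjugation and factor through the kernel, because Z/4
    acts on itself with 4 points. Removing the twist factor keeps [level4], so the remaining signed
    permutation and shear are trivial. *)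
Lemma level4_twist_form n f : 4 <= n -> inner_mod n f ->
  exists w, \pi_(out F2) f = \pi_(out F2) (twist w).
Proof.
move=> n4 [k fk].
have [w [i [j [l [b [c fE]]]]]] := out_F2_form (\pi_(out F2) f).
have clM (u v : aut F2) : \pi_(out F2) (u * v) = \pi_(out F2) u * \pi_(out F2) v.
  exact: piM.
exists w; rewrite fE -clM.
move: fE; rewrite -!clM => /out_eqP[g fg].
have expf j' u : exponent4 j' (f u) = exponent4 j' u.
  by rewrite (exponent4_kernel _ n4 (fk u)) exponent4J.
have : level4 (twist w^-1 * (f * inner_aut g)).
  apply: level4_twist; rewrite /level4 !aut_mulE !expf !exponent4J.
  by vm_compute.
rewrite -fg /twist free_homV mulKg => /(implyP (level4_sign_shear _ _ _ _ _)).
rewrite !negb_or => /and4P[/negPf-> /negPf-> /negPf-> /negPf->].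
have -> : sign_perm false false false * shear_rep false c = 1.
  apply: autP; apply: F2_morph_ext => //; first exact: autM.
    by case: c {fg}; apply/eqP; vm_compute.
  by case: c {fg}; apply/eqP; vm_compute.
by rewrite clM mulg1.
Qed.

Lemma twist_out_congruence (N : finite_index_normal (out F2)) :
  exists n, forall w, inner_mod n (twist w) -> carrier N (\pi_(out F2) (twist w)).
Proof.
have [S [r [rM r_inj]]] := finite_group_perm (@fin_index _ N).
pose q (w : F2) : quotient_group N := \pi_(quotient_group N) (\pi_(out F2) (twist w)).
have qM : {morph q : u v / u * v}.
  by move=> u v; rewrite /q twistM (@piM _ (inn F2)) piM.
have [n nP] := twist_congruence (fun i => r (q (gen i))).
exists n => w [k wk].
have := nP w k wk.
have -> : free_hom (fun i => r (q (gen i))) w = r (q w).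
  apply/esym; apply: (free_hom_unique (f := r \o q)) => // u v /=.
  by rewrite qM rM.
rewrite -(morph_one rM) => /r_inj/esym/coset_piP.
by rewrite invg1 mul1g.
Qed.

Theorem out_F2_congruence (N : finite_index_normal (out F2)) :
  exists n, forall f, inner_mod n f -> carrier N (\pi_(out F2) f).
Proof.
have [m mP] := twist_out_congruence N.
exists (maxn m 4) => f fin.
have [w fw] := level4_twist_form (leq_maxr m 4) fin.
rewrite fw; apply: mP.
move: fw => /out_eqP[g ->]; have [k fk] := fin.
exists (k * g) => u; apply: (perm_kernel_mono (leq_maxl m 4)).
have := fk (g * u * g^-1); rewrite aut_mulE /=.
by rewrite invgM !mulgA.
Qed.

(** * Topology of completions and of their automorphism groups *)

(** Limits along this ultrafilter serve as the compactness arguments below; the final segments in it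
    make arbitrarily deep levels available. *)
Lemma ultra_nat : exists U : set_system nat,
  UltraFilter U /\ forall n, U [set m | n <= m].
Proof.
have [U [uU ooU]] := ultraFilterLemma (F := \oo) _.
by exists U; split=> // n; apply: ooU; exists n.
Qed.

Lemma ultra_finite (I : Type) (T : choiceType) (U : set_system I) (v : I -> T) :
  UltraFilter U -> finite_set [set: T] -> exists t, U [set i | v i = t].
Proof.
move=> uU; have pU : ProperFilter U by exact: ultra_proper.
move=> /finite_seqP[s sT].
have : U [set i | v i \in s].
  by apply: filterS filterT => i _; have : [set: T] (v i) by []; rewrite sT.
elim: s {sT} => [|t s IH] Us.
  by have [i] := filter_ex Us.
have [|Ut] := in_ultra_setVsetC [set i | v i = t] uU; first by exists t.
apply: IH; apply: filterS (filterI Us Ut) => i /= [].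
by rewrite inE => /orP[/eqP|].
Qed.

Section UltraLimit.
Variables (I : Type) (U : set_system I) (uU : UltraFilter U).

(** This is compactness of the completion: each coordinate takes finitely many values, so it is
    constant on a member of [U]; any two members meet, which gives compatibility. *)
Lemma completion_ultra_limit (G : groupType) (k : I -> completion G) :
  exists z : completion G, forall N, U [set i | k i N = z N].
Proof.
have pU : ProperFilter U by exact: ultra_proper.
have ex (N : finite_index_normal G) : exists t, U [set i | k i N = t].
  exact: ultra_finite uU (@fin_index _ N).
pose z N := projT1 (cid (ex N)).
have zP N : U [set i | k i N = z N] := projT2 (cid (ex N)).
have zc (N M : finite_index_normal G) : N `<=` M ->
    \pi_(quotient_group M) (repr (z N)) = z M.
  move=> NM; have [i [<- <-]] := filter_ex (filterI (zP N) (zP M)).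
  exact: coord_compat.
by exists (Completion zc).
Qed.

End UltraLimit.

Section MeetIndex.
Variables (G : groupType) (N M : finite_index_normal G).

Lemma meet_group_closed : group_closed [in (N `&` M : set G)].
Proof.
split=> [|x y]; rewrite !inE; first by split; exact: subgroup1.
by move=> [Nx Mx] [Ny My]; split; apply: subgroupM => //; exact: subgroupV.
Qed.

Definition meet_normal : normal_subgroup G :=
  @NormalSubgroup _ (Subgroup meet_group_closed) (fun x y xNM =>
    conj (normal_subgroupJ y xNM.1) (normal_subgroupJ y xNM.2)).

Lemma meet_index : finite_set [set: quotient_group meet_normal].
Proof.
have [S [r [_ r_inj]]] := finite_group_perm (@fin_index _ N).
have [T [t [_ t_inj]]] := finite_group_perm (@fin_index _ M).
apply: (fin_index_of_map (f := fun g =>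
  (r (\pi_(quotient_group N) g), t (\pi_(quotient_group M) g)))) => x y.
by case=> /r_inj/coset_piP Nxy /t_inj/coset_piP Mxy; split.
Qed.

Definition meet_fin : finite_index_normal G := FiniteIndexNormal meet_index.

End MeetIndex.

Lemma cvg_initial (Y : choiceType) (Z : topologicalType) (w : Y -> Z)
    (F : set_system Y) (y : Y) : Filter F ->
  w @ F --> w y -> F --> (y : initial_topology w).
Proof.
move=> FF wF O [_ [[W oW <-] Wy] WO]; apply: filterS WO _.
by apply: wF; exact: open_nbhs_nbhs.
Qed.

Lemma cvg_initial_discrete (I : eqType) (Y : choiceType) (T : I -> choiceType)
    (w : Y -> forall i, T i) (F : set_system Y) (y : Y) : Filter F ->
  (forall i, F [set u | w u i = w y i]) ->
  F --> (y : initial_topology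
    (w : Y -> prod_topology (fun i => discrete_topology (T i)))).
Proof.
move=> FF Fw; apply: cvg_initial; apply/cvg_sup => i.
apply: cvg_initial; apply/discrete_cvg.
exact: Fw.
Qed.

Lemma nbhs_initial_discrete (I : eqType) (Y : choiceType) (T : I -> choiceType)
    (w : Y -> forall i, T i) (y : Y) i :
  nbhs (y : initial_topology
    (w : Y -> prod_topology (fun i => discrete_topology (T i))))
    [set u | w u i = w y i].
Proof.
pose D i : topologicalType := discrete_topology (T i).
have wi := discrete_set1 (w y i : D i).
have := @proj_continuous _ D i (w y) _ wi.
exact: (@initial_continuous _ (prod_topology D) w y).
Qed.

(** The sets described by the conclusion form a filter, since two coordinates are functions of the
    one at [meet_fin]; the claim is that this filter converges to [x]. *)
Lemma nbhs_completion (G : groupType) (x : completion G) (O : set (completion G)) :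
  nbhs x O -> exists N, forall y : completion G, y N = x N -> O y.
Proof.
pose F : set_system (completion G) :=
  [set S | exists N, forall y : completion G, y N = x N -> S y].
have [N0 _] : exists N : finite_index_normal G, True.
  have gT : group_closed [in ([set: G] : set G)] by split=> [|u v]; rewrite !inE.
  have nT (u v : G) : carrier (Subgroup gT) u -> carrier (Subgroup gT) (u ^ v) by [].
  have fT : finite_set [set: quotient_group (@NormalSubgroup _ (Subgroup gT) nT)].
    exact: (fin_index_of_map (f := fun=> tt)).
  by exists (FiniteIndexNormal fT).
have FF : Filter F.
  split=> [|A B [N NA] [M MB]|A B AB [N NA]]; first by exists N0.
    exists (meet_fin N M) => y yx; split; [apply: NA|apply: MB].
      by rewrite -!(@coord_compat _ _ (meet_fin N M) N) ?yx // => z [].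
    by rewrite -!(@coord_compat _ _ (meet_fin N M) M) ?yx // => z [].
  by exists N => y /NA /AB.
have := @cvg_initial_discrete _ _ _ (@coord G) F x FF.
by apply=> // N; exists N.
Qed.

Lemma to_completion_dense (G : groupType) (x : completion G) (O : set (completion G)) :
  nbhs x O -> exists q : G, O (to_completion q).
Proof.
move=> /nbhs_completion[N NO]; exists (repr (x N)); apply: NO.
by rewrite /= reprK.
Qed.

Section ContAutTopology.
Variable G : topologicalGroupType.
Implicit Types (f k : cont_aut G) (H : subgroup G).

Lemma small_index_mono m n : m <= n -> small_index G n `<=` small_index G m.
Proof.
move=> mn x xn H oH Hm; apply: xn => //; apply: card_le_trans Hm _.
by rewrite card_le_II.
Qed.

Lemma preimage_subgroup_closed f H : group_closed [in f @^-1` H].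
Proof.
split=> [|x y]; rewrite !inE /preimage /=; first by rewrite aut1; exact: subgroup1.
by move=> Hx Hy; rewrite autM autV; apply: subgroupM => //; exact: subgroupV.
Qed.

(** The preimage under [f] of an open subgroup of index at most [n] is again one. *)
Lemma small_index_cont_aut f n x : carrier (small_index G n) x ->
  carrier (small_index G n) (f x).
Proof.
move=> xn H oH Hn; pose fH := Subgroup (preimage_subgroup_closed f H).
have [cf _] : continuous f /\ continuous (aut_inv f) by exact/asboolP/(cont_autP f).
apply: (xn fH).
  by apply: open_comp => // y _; exact: cf.
apply: card_le_trans Hn.
pose j (q : coset_space fH) := \pi_(coset_space H) (f (repr q)).
have j_inj : {in [set: coset_space fH] &, injective j}.
  move=> p q _ _ /coset_eqP/asboolP; rewrite -autV -autM => pq.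
  rewrite -[p]reprK -[q]reprK; apply/coset_eqP/asboolP; exact: pq.
rewrite -(card_le_eql (inj_card_eq j_inj)).
exact: subset_card_le.
Qed.

Definition aut_near n f k := forall x, carrier (small_index G n) ((f x)^-1 * k x).

Lemma aut_near_refl n f : aut_near n f f.
Proof. by move=> x; rewrite mulVg; exact: subgroup1. Qed.

Lemma aut_near_trans n f k l : aut_near n f k -> aut_near n k l -> aut_near n f l.
Proof.
by move=> fk kl x; have := subgroupM (fk x) (kl x); rewrite mulgA mulgK.
Qed.

Lemma aut_near_mono m n f k : m <= n -> aut_near n f k -> aut_near m f k.
Proof. by move=> mn fk x; exact: small_index_mono (fk x). Qed.

Lemma aut_near_mul n f k l : aut_near n f k -> aut_near n (f * l) (k * l).
Proof. by move=> fk x; exact: fk. Qed.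

Lemma aut_near_induced n f k : @induced G k n = @induced G f n -> aut_near n f k.
Proof.
move=> kf x; pose q := \pi_(coset_space (small_index G n)) x.
have /asboolP := introT (coset_eqP _ _ _) (esym (congr1 (fun u => u q) kf)).
have /asboolP := introT (coset_eqP _ _ _) (reprK q).
move=> xu fk; have := subgroupM fk (small_index_cont_aut k xu).
have := subgroupV (small_index_cont_aut f xu).
move=> fu; move=> /(subgroupM fu).
by rewrite !autM !autV invgM invgK !mulgA !mulgK.
Qed.

Lemma nbhs_aut_near n f : nbhs f [set k | aut_near n f k].
Proof.
have := @nbhs_initial_discrete _ _ _ (@induced G) f n.
by apply: filterS => k /aut_near_induced.
Qed.

Lemma nbhs_cont_aut f (O : set (cont_aut G)) : nbhs f O ->
  exists n, forall k, aut_near n f k -> O k.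
Proof.
pose F : set_system (cont_aut G) :=
  [set S | exists n, forall k, aut_near n f k -> S k].
have FF : Filter F.
  split=> [|A B [m mA] [n nB]|A B AB [n nA]]; first by exists 0.
    exists (maxn m n) => k fk; split; [apply: mA|apply: nB].
      exact: aut_near_mono (leq_maxl _ _) fk.
    exact: aut_near_mono (leq_maxr _ _) fk.
  by exists n => y /nA /AB.
have := @cvg_initial_discrete _ _ _ (@induced G) F f FF.
apply=> // n; exists n => k fk; apply/funext => q /=.
by apply/esym/coset_eqP/asboolP/fk.
Qed.

End ContAutTopology.

Lemma small_fintype (T : choiceType) n : [set: T] #<= `I_n ->
  exists (S : finType) (e : T -> S) (e' : S -> T),
    [/\ #|S| <= n, cancel e e' & cancel e' e].
Proof.
move=> /pcard_leP[f].
have f_inj : injective f by move=> s t; apply: 'inj_f; rewrite inE.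
have fn t : f t < n by have : `I_n (f t) by exact: funS.
pose S : finType := {j : 'I_n | `[< exists t, f t = j :> nat >]}.
have eP t : `[< exists u, f u = Ordinal (fn t) :> nat >] by apply/asboolP; exists t.
pose e t : S := exist _ (Ordinal (fn t)) (eP t).
have e'P (s : S) : exists t, f t = val s :> nat by case: s => j /= /asboolP.
pose e' (s : S) : T := projT1 (cid (e'P s)).
have e'E s : f (e' s) = val s :> nat := projT2 (cid (e'P s)).
exists S, e, e'; split=> [|t|s].
- by rewrite card_sig -[X in _ <= X](card_ord n); exact: max_card.
- by apply: f_inj; rewrite e'E.
- by apply/val_inj/val_inj; rewrite /= e'E.
Qed.

Section CosetAction.
Variables (G : groupType) (H : subgroup G).

Definition coset_act (g : G) (q : coset_space H) : coset_space H :=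
  \pi_(coset_space H) (g * repr q).

Lemma coset_act_pi g x :
  coset_act g (\pi_(coset_space H) x) = \pi_(coset_space H) (g * x).
Proof.
apply/coset_eqP/asboolP; rewrite invgM -mulgA mulKg.
by apply/asboolP/coset_eqP; rewrite reprK.
Qed.

Lemma coset_actM g k q : coset_act (g * k) q = coset_act g (coset_act k q).
Proof. by rewrite [coset_act k q]/coset_act coset_act_pi /coset_act mulgA. Qed.

Lemma coset_act1 q : coset_act 1 q = q.
Proof. by rewrite /coset_act mul1g reprK. Qed.

Lemma coset_act_base g :
  coset_act g (\pi_(coset_space H) 1) = \pi_(coset_space H) 1 -> carrier H g.
Proof.
rewrite coset_act_pi mulg1 => /esym/coset_eqP/asboolP.
by rewrite invg1 mul1g.
Qed.

(* The inverse turns the left action on cosets into a homomorphism, as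
   permutations compose from left to right. *)
Lemma coset_perm n : [set: coset_space H] #<= `I_n ->
  exists (S : finType) (r : G -> {perm S}), [/\ #|S| <= n,
    {morph r : x y / x * y} & forall g, r g = 1 -> carrier H g].
Proof.
move=> /small_fintype[S [e [e' [Sn eK e'K]]]].
pose a g s := e (coset_act g^-1 (e' s)).
have a_inj g : injective (a g).
  move=> s t /(can_inj eK)/(congr1 (coset_act g)).
  by rewrite -!coset_actM mulgV !coset_act1 => /(can_inj e'K).
exists S, (fun g => perm (@a_inj g)); split=> // [x y|g].
  apply/perm.permP => s; rewrite permM !permE /a eK.
  by rewrite invgM coset_actM.
move=> /perm.permP/(_ (e (\pi_(coset_space H) 1))).
rewrite perm1 permE /a eK => /(can_inj eK)/coset_act_base/subgroupV.
by rewrite invgK.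
Qed.

End CosetAction.

(** Through its action on cosets, an open [H] of index at most [n] contains the image of
    [perm_kernel X n]. Up to an element of [H], [z] is the image of some [q], and [q] lies in that
    kernel because this coordinate of [z] is trivial. *)
Lemma kernel_small_index (X : finType) n (z : completion (free_group X)) :
  z (perm_kernel X n) = 1 -> carrier (small_index (completion (free_group X)) n) z.
Proof.
move=> zn H oH Hn.
have [S [r [Sn rM rH]]] := coset_perm Hn.
have toH k : carrier (perm_kernel X n) k -> carrier H (to_completion k).
  move=> kn; apply: rH.
  transitivity (free_hom (fun i => r (to_completion (gen i))) k).
    by apply: (free_hom_unique (f := r \o @to_completion _)) => // u v /=;
      rewrite to_completionM rM.
  exact: perm_kernel_act kn.
have /nbhs_completion[N NH] : nbhs (1 : completion (free_group X)) H.
  by apply: open_nbhs_nbhs; split=> //; exact: subgroup1.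
pose L := meet_fin N (perm_kernel X n); pose q := repr (z L).
have qL : \pi_(quotient_group L) q = z L by rewrite reprK.
have qN : \pi_(quotient_group N) q = z N by rewrite -(@coord_compat _ z L N) // => ? [].
have qn : \pi_(quotient_group (perm_kernel X n)) q = z (perm_kernel X n).
  by rewrite -(@coord_compat _ z L (perm_kernel X n)) // => ? [].
have Hq : carrier H (to_completion q).
  apply: toH; move: qn; rewrite zn => /esym/coset_piP.
  by rewrite invg1 mul1g.
have Hzq : carrier H (z^-1 * to_completion q).
  by apply: NH; suff : (z N)^-1 * \pi_(quotient_group N) q = 1; [|rewrite qN mulVg].
by have := subgroupM Hq (subgroupV Hzq); rewrite invgM invgK mulVKg.
Qed.

Section CoordSubgroup.
Variables (G : groupType) (N : finite_index_normal G).

Lemma coord_group_closed : group_closed [in [set z : completion G | z N = 1]].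
Proof.
split=> [|x y]; rewrite !inE //= => xN yN.
by suff : x N * (y N)^-1 = 1; [|rewrite xN yN mulgV].
Qed.

Definition coord_subgroup : subgroup (completion G) := Subgroup coord_group_closed.

(** A converse to [kernel_small_index]: the kernel of the coordinate at [N] is open, of index at
    most the order of the quotient by [N]. *)
Lemma small_index_coord : exists n, forall z : completion G,
  carrier (small_index (completion G) n) z -> z N = 1.
Proof.
have [n Nn] := @fin_index _ N; exists n => z zn; apply: (zn coord_subgroup).
  rewrite openE => y /= yN; apply: filterS (near_coord y N) => u uy.
  by rewrite /= uy.
rewrite -(card_le_eqr Nn).
pose j (q : coset_space coord_subgroup) := (repr q) N.
have j_inj : {in [set: coset_space coord_subgroup] &, injective j}.
  move=> p q _ _ pq; rewrite -[p]reprK -[q]reprK; apply/coset_eqP/asboolP => /=.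
  by suff : (j p)^-1 * j q = 1; [|rewrite pq mulVg].
rewrite -(card_le_eql (inj_card_eq j_inj)).
exact: subset_card_le.
Qed.

End CoordSubgroup.

(** * The natural homomorphism *)

Local Notation K n := (perm_kernel 'I_2 n).
Local Notation lev n g := (\pi_(quotient_group (K n)) g).
Local Notation F2hat := (completion F2).

Lemma lev_aut n (f : aut F2) g k : lev n g = lev n k -> lev n (f g) = lev n (f k).
Proof.
move=> /coset_piP gk; apply/coset_piP; rewrite -autV -autM.
exact: perm_kernel_aut.
Qed.

Lemma inner_modP n f :
  inner_mod n f <-> exists k, forall g, lev n (f g) = lev n (k * g * k^-1).
Proof. by split=> -[k fk]; exists k => g; apply/coset_piP/fk. Qed.

Lemma inner_mod_mul n f k : inner_mod n f -> inner_mod n k -> inner_mod n (f * k).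
Proof.
move=> /inner_modP[u fu] /inner_modP[v kv]; apply/inner_modP; exists (u * v) => g.
rewrite aut_mulE fu !piM kv invgM !piM.
by rewrite !mulgA.
Qed.

Lemma inner_mod_inv n f : inner_mod n f -> inner_mod n f^-1.
Proof.
move=> /inner_modP[u fu]; apply/inner_modP; exists u^-1 => g.
have := fu (aut_inv f g); rewrite aut_invK aut_invE !piM => ->.
by rewrite !piV invgK !mulgA mulVg mul1g mulgVK.
Qed.

Lemma inner_mod_inner n g : inner_mod n (inner_aut g).
Proof. by apply/inner_modP; exists g. Qed.

Lemma inner_mod_conj n f k : inner_mod n f -> inner_mod n (f ^ k).
Proof.
move=> /inner_modP[u fu]; apply/inner_modP; exists (aut_inv k u) => g.
rewrite conjgE !aut_mulE aut_invE.
rewrite (lev_aut k^-1 (fu _)) aut_invE !aut_invM aut_funK.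
by rewrite -[aut_inv k u^-1]/(k^-1 u^-1) autV.
Qed.

Definition inner_out_set n : set (out F2) :=
  [set o | exists2 f, o = \pi_(out F2) f & inner_mod n f].

Lemma inner_out_group_closed n : group_closed [in inner_out_set n].
Proof.
split=> [|x y]; rewrite !inE; first by exists 1 => //; apply/inner_modP; exists 1 => g;
  rewrite invg1 mulg1 mul1g.
move=> [f -> fn] [k -> kn]; exists (f * k^-1).
  by rewrite (@piM _ (inn F2)) (@piV _ (inn F2)).
exact/inner_mod_mul/inner_mod_inv.
Qed.

Lemma inner_outJ n x y : inner_out_set n x -> inner_out_set n (x ^ y).
Proof.
move=> [f -> fn]; exists (f ^ repr y); last exact: inner_mod_conj.
rewrite !conjgE (@piM _ (inn F2)) (@piV _ (inn F2)) (@piM _ (inn F2)).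
by rewrite [\pi_(quotient_group (inn F2)) (repr y)]reprK.
Qed.

Definition inner_out_normal n : normal_subgroup (out F2) :=
  @NormalSubgroup _ (Subgroup (inner_out_group_closed n)) (@inner_outJ n).

Lemma inner_out_index n : finite_set [set: quotient_group (inner_out_normal n)].
Proof.
apply: (fin_index_of_map (f := fun o : out F2 => [ffun h : {ffun 'I_2 -> {perm 'I_n}} =>
  [ffun i : 'I_2 => free_hom h ((repr o : aut F2) (gen i))]])) => x y xy.
exists ((repr x)^-1 * repr y).
  by rewrite (@piM _ (inn F2)) (@piV _ (inn F2)) ![\pi_(quotient_group (inn F2)) _]reprK.
apply/inner_modP; exists 1 => g; rewrite invg1 mulg1 mul1g aut_mulE.
rewrite -{2}(aut_funK (repr x) g) -aut_invE; apply: lev_aut.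
apply/esym/perm_kernel_eqP => h.
have hE : free_hom h =1 free_hom [ffun i => h i].
  apply: free_hom_ext => [||i]; [exact: free_homM..|].
  by rewrite !free_hom_gen ffunE.
rewrite !hE; apply: (free_hom_ext (f1 := free_hom _ \o repr x)
    (f2 := free_hom _ \o repr y)) => [u v|u v|i] /=.
- by rewrite autM free_homM.
- by rewrite autM free_homM.
have := congr1 (fun u : {ffun {ffun 'I_2 -> {perm 'I_n}} -> {ffun 'I_2 -> {perm 'I_n}}} =>
  u [ffun i => h i] i) xy.
by rewrite !ffunE.
Qed.

Definition inner_out n : finite_index_normal (out F2) :=
  FiniteIndexNormal (inner_out_index n).

Lemma inner_out_mono m n : m <= n -> inner_out n `<=` inner_out m.
Proof.
move=> mn o [f -> [k fk]]; exists f => //; exists k => g.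
exact: perm_kernel_mono mn _ (fk g).
Qed.

Lemma inner_out_pi n f : carrier (inner_out n) (\pi_(out F2) f) -> inner_mod n f.
Proof.
move=> [k /esym/out_eqP[g ->] kn].
exact: inner_mod_mul kn (inner_mod_inner n g).
Qed.

Local Notation oc n f := (\pi_(quotient_group (inner_out n)) (\pi_(out F2) f)).

Lemma inner_out_eq n f k : oc n f = oc n k ->
  exists u, forall g, lev n (k g) = lev n (u * f g * u^-1).
Proof.
move=> fk; have : oc n (k * f^-1) = oc n 1.
  rewrite (@piM _ (inn F2)) (@piV _ (inn F2)) (@piM _ (inner_out_normal n)).
  by rewrite (@piV _ (inner_out_normal n)) fk mulgV.
move=> /esym/coset_piP; rewrite -(@piV _ (inn F2)) -(@piM _ (inn F2)) invg1 mul1g.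
move=> /inner_out_pi/inner_modP[u ku]; exists u => g.
by rewrite -ku aut_mulE aut_invE aut_funK.
Qed.

Lemma extend_level n f (z : F2hat) :
  extend_fun f z (K n) = lev n (f (repr (z (K n)))).
Proof.
have sub : K n `<=` preimage_fin f (K n) by move=> g; exact: perm_kernel_aut.
rewrite [LHS]/(extend_coord f z (K n)) /extend_coord -(coord_compat z sub).
exact: (pi_aut_repr f (K n)).
Qed.

(* phi acts on the n-th level of the completion through some f in the class
   prescribed by x; modulo inner automorphisms this determines phi. *)
Definition extends_out (x : completion (out F2)) (phi : F2hat -> F2hat) :=
  forall n, exists2 f, oc n f = x (inner_out n) &
    forall z, phi z (K n) = lev n (f (repr (z (K n)))).

Lemma kernel_coord (N : finite_index_normal F2) : exists n, forall z t : F2hat,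
  z (K n) = t (K n) -> z N = t N.
Proof.
have [n nN] := perm_kernel_sub N; exists n => z t zt.
by rewrite -(coord_compat z nN) zt (coord_compat t nN).
Qed.

Lemma level_mono m n (z t : F2hat) : m <= n -> z (K n) = t (K n) -> z (K m) = t (K m).
Proof.
move=> mn zt; have sub := perm_kernel_mono (X := 'I_2) mn.
by rewrite -(coord_compat z sub) zt (coord_compat t sub).
Qed.

Lemma level_ext (z t : F2hat) : (forall n, z (K n) = t (K n)) -> z = t.
Proof.
by move=> zt; apply: completionP => N; have [n] := kernel_coord N; apply.
Qed.

(** Representatives of the coordinates of [x] are compatible only up to inner automorphisms. Taking
    the pointwise ultralimit of their extensions avoids the choice of compatible lifts. *)
Lemma extends_out_ex x : exists phi : cont_aut F2hat, extends_out x phi.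
Proof.
have [U [uU Uge]] := ultra_nat; have pU : ProperFilter U by exact: ultra_proper.
pose f n : aut F2 := repr (repr (x (inner_out n)) : out F2).
have fx n : oc n (f n) = x (inner_out n).
  by rewrite [\pi_(out F2) _]reprK reprK.
have limE (e : nat -> F2hat -> F2hat) (z : F2hat) :
    exists t : F2hat, forall N, U [set n | e n z N = t N].
  exact: completion_ultra_limit.
pose lim e z := projT1 (cid (limE e z)).
have limP (e : nat -> F2hat -> F2hat) (z : F2hat) (N : finite_index_normal F2) :
  U [set n | e n z N = lim e z N] := projT2 (cid (limE e z)) N.
pose ef n := extend_fun (f n); pose eg n := extend_fun (f n)^-1.
have level_dep n (k : aut F2) (z t : F2hat) : z (K n) = t (K n) ->
    extend_fun k z (K n) = extend_fun k t (K n).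
  by rewrite !extend_level => ->.
have limK (e e' : nat -> aut F2) : (forall n, cancel (extend_fun (e n)) (extend_fun (e' n))) ->
    cancel (lim (fun n => extend_fun (e n))) (lim (fun n => extend_fun (e' n))).
  move=> eK z; apply: level_ext => m.
  have [n [/= <- en]] := filter_ex (filterI
    (limP (fun n => extend_fun (e' n)) (lim (fun n => extend_fun (e n)) z) (K m))
    (limP (fun n => extend_fun (e n)) z (K m))).
  by have := level_dep m (e' n) (extend_fun (e n) z) _ en; rewrite eK => ->.
have limM : {morph lim ef : z t / z * t}.
  move=> z t; apply: completionP => N.
  have [n [ztn [zn tn]]] := filter_ex (filterI (limP ef (z * t) N)
    (filterI (limP ef z N) (limP ef t N))).
  have <- : ef n (z * t) N = lim ef (z * t) N := ztn.
  have {zn}zn : ef n z N = lim ef z N := zn.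
  have {tn}tn : ef n t N = lim ef t N := tn.
  rewrite /ef extend_funM.
  by suff : ef n z N * ef n t N = lim ef z N * lim ef t N; [|rewrite zn tn].
have fgK n : cancel (ef n) (eg n) by exact: extend_funK.
have gfK n : cancel (eg n) (ef n) by exact: extend_funVK.
have lim_cont (e : nat -> aut F2) : continuous (lim (fun n => extend_fun (e n))).
  apply: completion_continuous => N z.
  have [m mN] := kernel_coord N.
  apply: filterS (near_coord z (K m)) => t /= tz; apply: mN.
  have [n [/= <- <-]] := filter_ex (filterI (limP (fun n => extend_fun (e n)) t (K m))
    (limP (fun n => extend_fun (e n)) z (K m))).
  exact: level_dep.
pose phi := Automorphism (limK _ _ fgK) (limK _ _ gfK) limM.
have bphi : bicontinuous phi by apply/asboolP; split; exact: lim_cont.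
exists (ContAut bphi) => m.
(* At level [m] the images of the two generators take finitely many values, so one pair occurs on a
   member of [U]; some [n >= m] in it yields the representative for level [m]. *)
have [v mv] : exists v, U [set n |
    (lev m (f n F2x), lev m (f n F2y)) = v].
  apply: ultra_finite => //.
  have := finite_setX (@fin_index _ (K m)) (@fin_index _ (K m)).
  by rewrite setXTT.
have [n [/= nv mn]] := filter_ex (filterI mv (Uge m)).
exists (f n).
  rewrite -(coord_compat x (inner_out_mono mn)).
  by rewrite -(fx n) pi_repr //; exact: inner_out_mono.
move=> z.
have [l [zl lv]] := filter_ex (filterI (limP ef z (K m)) mv).
have <- : ef l z (K m) = phi z (K m) := zl.
rewrite /ef extend_level; apply: (F2_morph_ext (f := fun g => lev m (f l g))
  (k := fun g => lev m (f n g))) => [u w|u w||] /=.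
- by rewrite autM piM.
- by rewrite autM piM.
- by have := congr1 fst (etrans lv (esym nv)).
- by have := congr1 snd (etrans lv (esym nv)).
Qed.

(** The conjugators depend on the level; their ultralimit conjugates at all levels at once. *)
Lemma cont_out_eq (phi psi : cont_aut F2hat) :
  (forall n, exists k, forall z, phi z (K n) = (k * psi z * k^-1) (K n)) ->
  \pi_(cont_out F2hat) phi = \pi_(cont_out F2hat) psi.
Proof.
move=> /choice[k kP]; have [U [uU Uge]] := ultra_nat.
have pU : ProperFilter U by exact: ultra_proper.
have [u uP] := completion_ultra_limit uU k.
have phiE z : phi z = u * psi z * u^-1.
  apply: level_ext => n.
  have [m [um nm]] := filter_ex (filterI (uP (K n)) (Uge n)).
  rewrite (level_mono nm (kP m z)).
  by suff : k m (K n) * psi z (K n) * (k m (K n))^-1 = u (K n) * psi z (K n) * (u (K n))^-1;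
    [|rewrite um].
(* As [phi] is [psi] followed by conjugation by [u], the quotient [phi^-1 * psi] is conjugation by
   the preimage of [u^-1] under [psi]. *)
apply/coset_eqP/asboolP; exists (aut_inv psi u^-1) => //.
apply: autP => z; apply: (can_inj (aut_funK phi)).
rewrite [RHS]aut_invK [LHS]phiE /=.
by rewrite !autM autV aut_invK invgK !mulgA mulgV mul1g mulgK.
Qed.

Lemma extends_out_eq x (phi psi : cont_aut F2hat) :
  extends_out x phi -> extends_out x psi ->
  \pi_(cont_out F2hat) phi = \pi_(cont_out F2hat) psi.
Proof.
move=> phix psix; apply: cont_out_eq => n.
have [f fx phiE] := phix n; have [h hx psiE] := psix n.
have [u uE] := inner_out_eq (etrans hx (esym fx)).
exists (to_completion u) => z; rewrite phiE uE !piM piV -psiE.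
by [].
Qed.

Lemma extends_outM x y (phi psi : cont_aut F2hat) :
  extends_out x phi -> extends_out y psi -> extends_out (x * y) (phi * psi : cont_aut F2hat).
Proof.
move=> phix psiy n; have [f fx phiE] := phix n; have [h hy psiE] := psiy n.
exists (f * h).
  rewrite (@piM _ (inn F2)) (@piM _ (inner_out_normal n)).
  by suff : oc n f * oc n h = x (inner_out n) * y (inner_out n); [|rewrite fx hy].
move=> z; rewrite [LHS](phiE (psi z)); apply: lev_aut.
by rewrite reprK psiE.
Qed.

Lemma extends_out_extend (f : aut F2) :
  extends_out (to_completion (\pi_(out F2) f)) (extend f).
Proof. by move=> n; exists f => // z; exact: extend_level. Qed.

Definition extension_ex x := cid (extends_out_ex x).

Definition natural_fun (x : completion (out F2)) : cont_out F2hat :=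
  \pi_(cont_out F2hat) (projT1 (extension_ex x)).

Lemma natural_funE x (phi : cont_aut F2hat) :
  extends_out x phi -> natural_fun x = \pi_(cont_out F2hat) phi.
Proof. by move=> phix; apply: extends_out_eq phix; exact: projT2 (extension_ex x). Qed.

Lemma natural_funM : {morph natural_fun : x y / x * y}.
Proof.
move=> x y; rewrite (natural_funE (extends_outM (projT2 (extension_ex x))
  (projT2 (extension_ex y)))).
exact: (@piM _ (cont_inn F2hat)).
Qed.

Lemma natural_fun_completion q : natural_fun (to_completion q) = out_extend q.
Proof.
rewrite -[q]reprK out_extend_pi.
exact/natural_funE/extends_out_extend.
Qed.

Lemma near_of_level n (phi psi : cont_aut F2hat) :
  (forall z, phi z (K n) = psi z (K n)) -> aut_near n phi psi.
Proof.
move=> pp z; apply: kernel_small_index.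
by suff : (phi z (K n))^-1 * psi z (K n) = 1; [|rewrite pp mulVg].
Qed.

Lemma inner_bicontinuous (u : F2hat) : bicontinuous (inner_aut u).
Proof.
apply/asboolP; split; apply: completion_continuous => N z;
  apply: filterS (near_coord z N) => t /= tz.
- by suff : u N * t N * (u N)^-1 = u N * z N * (u N)^-1; [|rewrite tz].
- by suff : (u N)^-1 * (t N * u N) = (u N)^-1 * (z N * u N); [|rewrite tz].
Qed.

Definition cont_inner (u : F2hat) : cont_aut F2hat := ContAut (inner_bicontinuous u).

Lemma cont_out_inner u (phi : cont_aut F2hat) :
  \pi_(cont_out F2hat) (cont_inner u * phi : cont_aut F2hat) = \pi_(cont_out F2hat) phi.
Proof. by apply: cont_out_eq => n; exists u. Qed.

Lemma cont_outP (phi psi : cont_aut F2hat) :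
  \pi_(cont_out F2hat) phi = \pi_(cont_out F2hat) psi ->
  exists u, psi = phi * cont_inner u.
Proof.
move=> /coset_eqP/asboolP[u _ uE]; exists u; apply/val_inj/autP => z /=.
have := congr1 (fun f : aut F2hat => phi (f z)) uE.
by rewrite /= aut_invK => <-.
Qed.

(** If [y] agrees with [x] at [inner_out n], composing with an inner automorphism makes their lifts
    equal at level [n], hence close. *)
Lemma natural_fun_continuous : continuous natural_fun.
Proof.
apply/continuousP => O oO; rewrite openE => x /= Ox.
have [phi phix xE] : exists2 phi : cont_aut F2hat, extends_out x phi &
    natural_fun x = \pi_(cont_out F2hat) phi.
  by exists (projT1 (extension_ex x)) => //; exact: projT2 (extension_ex x).
rewrite /preimage /= xE in Ox.
have /nbhs_cont_aut[n nO] : nbhs phi (\pi_(cont_out F2hat) @^-1` O).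
  by apply: open_nbhs_nbhs; split.
apply: filterS (near_coord x (inner_out n)) => y /= yx.
have [psi psiy yE] : exists2 psi : cont_aut F2hat, extends_out y psi &
    natural_fun y = \pi_(cont_out F2hat) psi.
  by exists (projT1 (extension_ex y)) => //; exact: projT2 (extension_ex y).
rewrite yE; have [f fx phiE] := phix n; have [h hy psiE] := psiy n.
have [u uE] := inner_out_eq (etrans hy (etrans yx (esym fx))).
rewrite -(cont_out_inner (to_completion u)); apply: nO; apply: near_of_level => z.
rewrite phiE uE !piM piV -psiE.
by [].
Qed.

Definition near_out n (phi : cont_aut F2hat) : set (cont_out F2hat) :=
  [set c | exists2 chi, c = \pi_(cont_out F2hat) chi & aut_near n phi chi].

Lemma near_out_nbhs n phi : nbhs (\pi_(cont_out F2hat) phi) (near_out n phi).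
Proof.
apply: open_nbhs_nbhs; split; last by exists phi => //; exact: aut_near_refl.
suff : open (\pi_(cont_out F2hat) @^-1` near_out n phi) by [].
rewrite openE => chi [chi' /cont_outP[u ->] near_u].
apply: filterS (nbhs_aut_near n chi) => psi near_psi.
exists (psi * cont_inner u); last first.
  exact: aut_near_trans near_u (aut_near_mul _ near_psi).
by apply/coset_eqP/asboolP; exists u => //; rewrite mulKg.
Qed.

(** This makes the target separated: close lifts agree at a given level, so [phi] and [psi] are
    conjugate at every level, and [cont_out_eq] applies. *)
Lemma near_out_separates (phi psi : cont_aut F2hat) :
  (forall n, near_out n phi `&` near_out n psi !=set0) ->
  \pi_(cont_out F2hat) phi = \pi_(cont_out F2hat) psi.
Proof.
move=> near_pp; apply/esym/cont_out_eq => n.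
have [m mP] := small_index_coord (K n).
have near_level (f k : cont_aut F2hat) (fk : aut_near m f k) (z : F2hat) :
    k z (K n) = f z (K n).
  have := mP _ (fk z).
  rewrite -[LHS]/((f z (K n))^-1 * k z (K n)) => /mulg1_eq.
  by rewrite invgK.
have [c [[chi -> phi_chi] [chi' chiE psi_chi]]] := near_pp m.
have [u chi'E] := cont_outP chiE.
exists (chi u) => z; rewrite -(near_level _ _ psi_chi) chi'E.
rewrite -[LHS]/(chi (u * z * u^-1) (K n)) !autM autV.
suff : chi u (K n) * chi z (K n) * (chi u (K n))^-1 =
  chi u (K n) * phi z (K n) * (chi u (K n))^-1 by [].
by rewrite (near_level _ _ phi_chi z).
Qed.

(** Two continuous maps that agree on the dense image of [out F2] coincide, the target being
    separated. *)
Lemma natural_fun_unique Phi : natural_hom Phi -> natural_fun = Phi.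
Proof.
move=> [_ cPhi Phi_q]; apply/funext => x.
pose phi := projT1 (extension_ex x); pose psi : cont_aut F2hat := repr (Phi x).
rewrite -[RHS]reprK; apply: near_out_separates => n.
have nat_near : nbhs x (natural_fun @^-1` near_out n phi).
  exact: natural_fun_continuous (near_out_nbhs n phi).
have Phi_near : nbhs x (Phi @^-1` near_out n psi).
  by apply: cPhi; rewrite -[Phi x]reprK; exact: near_out_nbhs.
have [q [nq Pq]] := to_completion_dense (filterI nat_near Phi_near).
exists (out_extend q); split; first by rewrite -natural_fun_completion.
by rewrite -Phi_q.
Qed.

(** The congruence property places some [inner_out n] inside [N]. At level [n] a representative of
    [x] acts as the lift, which is inner, so the coordinate of [x] at [inner_out n], and with it the
    one at [N], is trivial. *)
Lemma natural_fun_eq1 x : natural_fun x = 1 -> x = 1.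
Proof.
move=> x1; apply: completionP => N; have [n nN] := out_F2_congruence N.
have sub : inner_out n `<=` N by move=> _ [f -> /nN].
suff -> : x N = (to_completion 1 : completion (out F2)) N by [].
rewrite -(coord_compat x sub) -(coord_compat (to_completion 1) sub).
congr (\pi_(quotient_group N) (repr _)).
have [f <- phiE] := projT2 (extension_ex x) n.
have [u phi_u] := cont_outP (esym x1).
apply/esym/coset_piP; rewrite invg1 mul1g; exists f => //; apply/inner_modP.
exists (repr (u (K n))) => g.
have := phiE (to_completion g); rewrite phi_u.
rewrite -[LHS]/(u (K n) * lev n g * (u (K n))^-1) !piM piV reprK => ->.
by apply: lev_aut; rewrite /= reprK.
Qed.

Lemma natural_fun_inj : injective natural_fun.
Proof.
move=> x y xy; apply: (mulgI x^-1); rewrite mulVg; apply/esym/natural_fun_eq1.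
by rewrite natural_funM -xy -natural_funM mulVg; exact: morph_one natural_funM.
Qed.

Theorem mainTheorem1 :
  exists Phi : completion (out F2) -> cont_out (completion F2),
    unique (@natural_hom F2) Phi /\ injective Phi.
Proof.
exists natural_fun; split; last exact: natural_fun_inj.
split; last exact: natural_fun_unique.
split; first exact: natural_funM; first exact: natural_fun_continuous.
exact: natural_fun_completion.
Qed.
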